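(* Let $\tau>0$ and let $E,A,B\in\mathbb{C}^{n,n}$ be pairwise commuting. Assume the IVP for the DDAE $E\dot x(t)=Ax(t)+Bx(t-\tau)+f(t)$, $t\ge0$, $x|_{[-\tau,0]}=\varphi$, is uniquely solvable, and that initial functions are sufficiently smooth. Let $U\in\mathbb{C}^{n,n}$ be nonsingular with $UEU^{-1}=\mathrm{diag}(J^E,N^E_2,N^E_3,N^E_4)$, $UAU^{-1}=\mathrm{diag}(A_1,J^A,N^A_3,N^A_4)$, $UBU^{-1}=\mathrm{diag}(B_1,B_2,J^B,N^B_4)$, where $J^E,J^A,J^B$ are nonsingular and the $N$-blocks are nilpotent. Consider the homogeneous DDAE $E\dot x(t)=Ax(t)+Bx(t-\tau)$ and let $\sigma(E,A,B)=\{\lambda\in\mathbb{C}:\det(\lambda E-A-e^{-\lambda\tau}B)=0\}$. Then: (i) if $\sigma(E,A,B)\subseteq\mathbb{C}_-$ and $N^E_2=0$, the null solution of the homogeneous DDAE is exponentially stable; (ii) if $\sigma(E,A,B)\subseteq\mathbb{C}_-$, the null solution is $C^\zeta$-weakly exponentially stable, where $\zeta$ is the nilpotency index of $N^E_2$.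
   Context: $\mathbb{C}_-=\{\lambda:\mathrm{Re}\,\lambda<0\}$. Solutions are piecewise differentiable: continuous $x$ with $Ex$ piecewise continuously differentiable satisfying the equation for all $t\in[0,\infty)\setminus\bigcup_{j\in\mathbb{N}_0}\{j\tau\}$; an initial function is consistent if the IVP has a solution. For $0\le p\le\infty$, $\|\varphi\|_{C^p}=\sum_{i=0}^p\sup_{t\in[-\tau,0]}\|\varphi^{(i)}(t)\|$. The null solution is exponentially stable if there are $\delta,\gamma>0$ with $\|x(t)\|\le\delta e^{-\gamma t}\sup_{[-\tau,0]}\|\varphi\|$ for all $t\ge0$ and all consistent continuous $\varphi$; it is $C^p$-weakly exponentially stable if there are $\delta,\gamma>0$ with $\|x(t)\|\le\delta e^{-\gamma t}\|\varphi\|_{C^p}$ for all $t\ge0$ and all consistent $\varphi\in C^p([-\tau,0],\mathbb{C}^n)$. *)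

(* Defs.v *)
From HB Require Import structures.
From mathcomp Require Import all_boot all_order all_algebra.
From mathcomp Require Import all_classical all_reals all_analysis.
From mathcomp Require Import complex.
Set Implicit Arguments. Unset Strict Implicit. Unset Printing Implicit Defensive.
Import Order.TTheory GRing.Theory Num.Theory.
Import numFieldNormedType.Exports.
Local Open Scope ring_scope.
Local Open Scope classical_set_scope.

Section Defs.
Variable R : realType.
Local Notation C := (R[i]).

Definition cexp (z : C) : C :=
  ((expR (complex.Re z))%:C)%C * (cos (complex.Im z) +i* sin (complex.Im z))%C.

Definition cabs (z : C) : R := Num.sqrt (complex.Re z ^+ 2 + complex.Im z ^+ 2).

Definition vnorm (n : nat) (v : 'cV[C]_n) : R := \big[Num.max/0]_(i < n) cabs (v i 0).

Definition ccont_within (n : nat) (D : set R) (g : R -> 'cV[C]_n) : Prop :=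
  forall i : 'I_n,
    {within D, continuous (fun s => complex.Re (g s i 0))} /\
    {within D, continuous (fun s => complex.Im (g s i 0))}.

Definition has_deriv (n : nat) (g : R -> 'cV[C]_n) (t : R) (d : 'cV[C]_n) : Prop :=
  forall i : 'I_n,
    is_derive t 1 (fun s => complex.Re (g s i 0)) (complex.Re (d i 0)) /\
    is_derive t 1 (fun s => complex.Im (g s i 0)) (complex.Im (d i 0)).

Definition pw_C1 (n : nat) (g : R -> 'cV[C]_n) : Prop :=
  exists b : nat -> R,
    [/\ b 0%N = 0, (forall k, b k < b k.+1), (forall M : R, exists k, M < b k) &
     forall k, exists g' : R -> 'cV[C]_n,
       [/\ ccont_within [set s | b k <= s <= b k.+1] g,
           ccont_within [set s | b k <= s <= b k.+1] g' &
           forall s, b k < s < b k.+1 -> has_deriv g s (g' s)]].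

Definition is_sol (n : nat) (tau : R) (E A B : 'M[C]_n) (f phi x : R -> 'cV[C]_n) : Prop :=
  [/\ ccont_within [set s | - tau <= s] x,
      (forall s, - tau <= s <= 0 -> x s = phi s),
      pw_C1 (fun s => E *m x s) &
      forall t, 0 <= t -> (forall j : nat, t != j%:R * tau) ->
        has_deriv (fun s => E *m x s) t (A *m x t + B *m x (t - tau) + f t)].

Definition zerof (n : nat) : R -> 'cV[C]_n := fun _ => 0.

Definition uniquely_solvable (n : nat) (tau : R) (E A B : 'M[C]_n) : Prop :=
  forall f phi x y : R -> 'cV[C]_n, is_sol tau E A B f phi x -> is_sol tau E A B f phi y ->
    forall t, - tau <= t -> x t = y t.

Definition supn (n : nat) (tau : R) (phi : R -> 'cV[C]_n) : R :=
  sup [set vnorm (phi t) | t in [set s | - tau <= s <= 0]].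

Definition exp_stable (n : nat) (tau : R) (E A B : 'M[C]_n) : Prop :=
  exists delta gamma : R, [/\ 0 < delta, 0 < gamma &
    forall phi x : R -> 'cV[C]_n,
      ccont_within [set s | - tau <= s <= 0] phi ->
      is_sol tau E A B (@zerof n) phi x ->
      forall t, 0 <= t -> vnorm (x t) <= delta * expR (- gamma * t) * supn tau phi].

(* phi is in C^p([-tau,0]) with derivatives ds 0 = phi, ds 1, ..., ds p
   (derivatives in the interior, all continuous on the closed interval,
   so that the endpoint values are the one-sided derivatives). *)
Definition Cp_derivs (n p : nat) (tau : R) (phi : R -> 'cV[C]_n) (ds : nat -> R -> 'cV[C]_n) : Prop :=
  [/\ (forall s, - tau <= s <= 0 -> ds 0%N s = phi s),
      (forall i, (i <= p)%N -> ccont_within [set s | - tau <= s <= 0] (ds i)) &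
      (forall i, (i < p)%N -> forall s, - tau < s < 0 -> has_deriv (ds i) s (ds i.+1 s))].

Definition Cp_norm (n p : nat) (tau : R) (ds : nat -> R -> 'cV[C]_n) : R :=
  \sum_(i < p.+1) supn tau (ds i).

Definition weak_exp_stable (p n : nat) (tau : R) (E A B : 'M[C]_n) : Prop :=
  exists delta gamma : R, [/\ 0 < delta, 0 < gamma &
    forall (phi x : R -> 'cV[C]_n) (ds : nat -> R -> 'cV[C]_n),
      Cp_derivs p tau phi ds ->
      is_sol tau E A B (@zerof n) phi x ->
      forall t, 0 <= t -> vnorm (x t) <= delta * expR (- gamma * t) * Cp_norm p tau ds].

Definition spectrum (n : nat) (tau : R) (E A B : 'M[C]_n) : set C :=
  [set l | \det (l *: E - A - cexp (- (l * (tau%:C)%C)) *: B) = 0].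

Definition nilpotent (m : nat) (N : 'M[C]_m) : Prop := exists k : nat, N ^+ k = 0.

Definition diag4 (n1 n2 n3 n4 : nat) (M1 : 'M[C]_n1) (M2 : 'M[C]_n2)
  (M3 : 'M[C]_n3) (M4 : 'M[C]_n4) : 'M[C]_(n1 + n2 + (n3 + n4)) :=
  block_mx (block_mx M1 0 0 M2) 0 0 (block_mx M3 0 0 M4).

End Defs.

(* Main.v *)
(* Commuting pencils decouple along the four diagonal blocks.

   - The last block is empty: commuting nilpotent matrices have a common
     eigenvector, so its pencil would be singular at [lambda = 0].
   - On the third block (nilpotent [E], [A], invertible [B]) every solution
     vanishes: [E^a A^b y = 0] follows by descending induction on [a + b].
   - On the second block (nilpotent [E], invertible [A]) the equation reads
     [y = (M y)' + L y(. - tau)] with [M] nilpotent, so on the [k]-th delay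
     interval [y] is an explicit combination of the [M^i L^k phi^(i)]; the
     spectral condition forces the eigenvalues of [L] into the open unit disc.
   - On the first block (invertible [E]) one has a retarded equation. Let [T] be
     the shift by [tau] on its solutions. For [|z| <= 1], inverting [1 - z T] is a
     boundary value problem on one delay interval. In triangular coordinates it
     is solved by back substitution, the denominators being
     [1 - z exp((a + b z) tau)]; these do not vanish, since a zero [z] would give
     the characteristic root [a + b z], whose real part is nonnegative.

   A bound on [(1 - z T)^-1] over the closed unit disc implies geometric decay of
   the powers of [T]. The proof replaces contour integrals by averages over roots
   of unity, and analytic continuation by a gain in radius that is uniform up to
   the unit circle, so that neither Laplace transforms nor complex analysis is
   needed. *)
Require Import Defs.
From HB Require Import structures.
From mathcomp Require Import all_boot all_order all_algebra.
From mathcomp Require Import cyclic separable cyclotomic.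
From mathcomp Require Import all_classical all_reals all_analysis.
From mathcomp Require Import complex.
From mathcomp Require Import ring lra zify.
Set Implicit Arguments. Unset Strict Implicit. Unset Printing Implicit Defensive.
Import Order.TTheory GRing.Theory Num.Theory.
Import numFieldNormedType.Exports.
Local Open Scope ring_scope.
Local Open Scope classical_set_scope.

(** * Moduli and roots of unity *)

Section Modulus.
Variable R : realType.
Implicit Types z w : R[i].

Lemma cabsE z : cabs z = Normc.normc z.
Proof. by case: z. Qed.

Lemma cabs_ge0 z : 0 <= cabs z.
Proof. exact: sqrtr_ge0. Qed.

Lemma cabs0 : cabs (0 : R[i]) = 0.
Proof. by rewrite cabsE Normc.normc0. Qed.

Lemma cabs1 : cabs (1 : R[i]) = 1.
Proof. by rewrite cabsE Normc.normc1. Qed.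

Lemma cabsM z w : cabs (z * w) = cabs z * cabs w.
Proof. by rewrite !cabsE Normc.normcM. Qed.

Lemma cabsV z : cabs z^-1 = (cabs z)^-1.
Proof. by rewrite !cabsE Normc.normcV. Qed.

Lemma cabsD z w : cabs (z + w) <= cabs z + cabs w.
Proof. by rewrite !cabsE le_normcD. Qed.

Lemma cabsN z : cabs (- z) = cabs z.
Proof. by rewrite !cabsE normcN. Qed.

Lemma cabsX z n : cabs (z ^+ n) = cabs z ^+ n.
Proof. by elim: n => [|n IH]; rewrite ?cabs1 // !exprS cabsM IH. Qed.

Lemma cabs_real (x : R) : cabs (x%:C)%C = `|x|.
Proof. by rewrite /cabs /= expr0n addr0 sqrtr_sqr. Qed.

Lemma cabs_nat n : cabs (n%:R : R[i]) = n%:R.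
Proof. by rewrite -(rmorph_nat (real_complex R)) cabs_real normr_nat. Qed.

Lemma cabs_eq0 z : cabs z = 0 -> z = 0.
Proof. by rewrite cabsE; exact: Normc.eq0_normc. Qed.

Lemma cabs_gt0 z : (0 < cabs z) = (z != 0).
Proof.
rewrite lt0r cabs_ge0 andbT; apply/idP/idP; apply: contra => /eqP.
  by move=> ->; rewrite cabs0.
by move/cabs_eq0 ->.
Qed.

Lemma cabs_sum (I : Type) (r : seq I) (P : pred I) (F : I -> R[i]) :
  cabs (\sum_(i <- r | P i) F i) <= \sum_(i <- r | P i) cabs (F i).
Proof.
elim/big_rec2: _ => [|i x z _ IH]; first by rewrite cabs0.
by rewrite (le_trans (cabsD _ _)) // lerD2l.
Qed.

Lemma cabs_Re z : `|complex.Re z| <= cabs z.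
Proof. by rewrite -sqrtr_sqr /cabs ler_wsqrtr // lerDl sqr_ge0. Qed.

Lemma cabs_Im z : `|complex.Im z| <= cabs z.
Proof. by rewrite -sqrtr_sqr /cabs ler_wsqrtr // lerDr sqr_ge0. Qed.

Lemma cabs_ReIm z : cabs z <= `|complex.Re z| + `|complex.Im z|.
Proof.
rewrite -[leRHS]ger0_norm ?addr_ge0 // -sqrtr_sqr /cabs ler_wsqrtr //.
rewrite sqrrD !real_normK ?num_real // lerD2r lerDl mulrn_wge0 //. 
Qed.

End Modulus.

(** [X^n - 1] splits and is separable in characteristic zero, so its [n] distinct roots include a
    primitive one. *)
Lemma exists_prim_root (F : numClosedFieldType) n :
  (0 < n)%N -> exists z : F, n.-primitive_root z.
Proof.
pose p : {poly F} := 'X^n - 1; have [r Dp] := closed_field_poly_normal p.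
move=> n_gt0; rewrite (monicP _) ?monicXnsubC // scale1r in Dp.
have rn1: all n.-unity_root r by apply/allP=> z; rewrite -root_prod_XsubC -Dp.
have sz_r: (n < (size r).+1)%N.
  by rewrite -(size_prod_XsubC r id) -Dp size_XnsubC.
have [|z] := hasP (has_prim_root n_gt0 rn1 _ sz_r); last by exists z.
by rewrite -separable_prod_XsubC -Dp separable_Xn_sub_1 // pnatr_eq0 -lt0n.
Qed.

(** Off the diagonal this is a geometric sum whose ratio [q] differs from 1 and satisfies
    [q ^+ K = 1]. It isolates one coefficient of a polynomial of degree below [K]. *)
Lemma sum_prim_root_pow (F : fieldType) K (w : F) (k n : nat) :
  K.-primitive_root w -> (k < K)%N -> (n < K)%N ->
  \sum_(j < K) (w ^+ j) ^+ k / (w ^+ j) ^+ n = if k == n then K%:R else 0.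
Proof.
move=> pw kK nK.
have w0 : w != 0.
  apply/eqP => w0; have := prim_expr_order pw; rewrite w0 expr0n.
  by rewrite gtn_eqF ?(leq_ltn_trans _ kK) // => /eqP; rewrite eq_sym oner_eq0.
case: eqP => [->|/eqP kn].
  rewrite (eq_bigr (fun=> 1)) ?sumr_const ?card_ord // => j _.
  by rewrite divff // !expf_neq0.
pose q := w ^+ k / w ^+ n.
have q1 : q - 1 != 0.
  rewrite subr_eq0; apply: contra kn => /eqP /(congr1 (fun x => x * w ^+ n)).
  rewrite mul1r mulfVK ?expf_neq0 // => /eqP.
  by rewrite (eq_prim_root_expr pw) !modn_small.
apply: (mulfI q1); rewrite mulr0 (eq_bigr (fun j : 'I_K => q ^+ j)); last first.
  by move=> j _; rewrite expr_div_n -!exprM ![(j * _)%N]mulnC !exprM.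
rewrite -subrX1 /q expr_div_n -!exprM ![(_ * K)%N]mulnC !exprM.
by rewrite (prim_expr_order pw) !expr1n divr1 subrr.
Qed.

(** * Decay of powers from a resolvent bound *)

(* [Bd v x] stands for the bound [N v <= x] on a seminorm [N]; working with the
   relation avoids suprema. *)
Section PowerDecay.
Variables (R : realType) (V : lmodType R[i]) (S : V -> Prop) (T : V -> V).
Variable Bd : V -> R -> Prop.
Hypothesis T_lin : forall (c : R[i]) (u v : V), T (c *: u + v) = c *: T u + T v.
Hypothesis S0 : S 0.
Hypothesis SD : forall u v, S u -> S v -> S (u + v).
Hypothesis SZ : forall c u, S u -> S (c *: u).
Hypothesis ST : forall u, S u -> S (T u).
Hypothesis Bd0 : Bd 0 0.
Hypothesis BdD : forall u v (x y : R), Bd u x -> Bd v y -> Bd (u + v) (x + y).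
Hypothesis BdZ : forall c u (x : R), Bd u x -> Bd (c *: u) (cabs c * x).
Hypothesis Bd_le : forall u (x y : R), x <= y -> Bd u x -> Bd u y.
Hypothesis Bd_lim : forall u (x : R), (forall e : R, 0 < e -> Bd u (x + e)) -> Bd u x.
Variables (c0 M : R).
Hypothesis c0_ge1 : 1 <= c0.
Hypothesis M_ge1 : 1 <= M.
Hypothesis BdT : forall u (x : R), S u -> 0 <= x -> Bd u x -> Bd (T u) (c0 * x).
(** An a priori estimate for [1 - z T] on the closed unit disc; below it is applied to weighted
    truncated Neumann series. *)
Hypothesis BdR : forall z u (x : R), cabs z <= 1 -> S u -> 0 <= x ->
  Bd (u - z *: T u) x -> Bd u (M * x).

Let q z k v : V := z ^+ k *: iter k T v.

Let T0 : T 0 = 0.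
Proof. by have := T_lin (-1) 0 0; rewrite scaler0 addr0 scaleN1r addNr. Qed.

Let TZ c u : T (c *: u) = c *: T u.
Proof. by rewrite -[c *: u]addr0 T_lin T0 !addr0. Qed.

Let TD u v : T (u + v) = T u + T v.
Proof. by have := T_lin 1 u v; rewrite !scale1r. Qed.

Let iterZ k c v : iter k T (c *: v) = c *: iter k T v.
Proof. by elim: k => //= k ->; rewrite TZ. Qed.

Let Siter k v : S v -> S (iter k T v).
Proof. by move=> Sv; elim: k => //= k; exact: ST. Qed.

Let Ssum (I : Type) (r : seq I) (P : pred I) (F : I -> V) :
  (forall i, S (F i)) -> S (\sum_(i <- r | P i) F i).
Proof. by move=> SF; elim/big_ind: _. Qed.

Let Bd_sum n (F : 'I_n -> V) (x : R) :
  (forall i, Bd (F i) x) -> Bd (\sum_(i < n) F i) (n%:R * x).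
Proof.
elim: n F => [|n IH] F BF; first by rewrite big_ord0 mul0r.
by rewrite big_ord_recr /= -natr1 mulrDl mul1r; apply: BdD => //; exact: IH.
Qed.

Let BdB u v x y : Bd u x -> Bd v y -> Bd (u - v) (x + y).
Proof.
move=> ux vy; apply: BdD => //; rewrite -scaleN1r.
by have := BdZ (-1) vy; rewrite cabsN cabs1 mul1r.
Qed.

(* Abel summation: [1 - z T] applied to a weighted truncated Neumann series. *)
Let abel z (w : nat -> R[i]) K v :
  let W := \sum_(0 <= k < K) w k *: q z k v in
  W - z *: T W = w 0%N *: v + \sum_(0 <= k < K) (w k.+1 - w k) *: q z k.+1 v
    - w K *: q z K v.
Proof.
rewrite /=; elim: K => [|K IH].
  by rewrite !big_geq // T0 scaler0 subr0 addr0 /q expr0 scale1r subrr.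
rewrite !big_nat_recr //= TD scalerDr opprD addrACA IH /q TZ TZ exprS.
rewrite !scalerA [(w K.+1 - w K) * _]mulrBl scalerBl mulrCA !mulrA.
set a := w 0%N *: v; set b := \sum_(0 <= i < K) _.
set c := (w K * _) *: _; set d := (z * w K * _) *: _; set e := _ *: _.
rewrite -!addrA; congr (_ + (_ + _)).
by rewrite addKr [w K * z]mulrC -/d [RHS]addrC subrK.
Qed.

(* Cauchy estimate, with the average over roots of unity in place of a contour
   integral. *)
Let cauchy K (u : nat -> V) (r x : R) n : 0 < r -> (n < K)%N ->
  (forall z, cabs z = r -> Bd (\sum_(0 <= k < K) z ^+ k *: u k) x) ->
  Bd (((r ^+ n)%:C)%C *: u n) x.
Proof.
move=> r0 nK Bz; have K0 : (0 < K)%N by apply: leq_ltn_trans nK.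
have [w pw] := @exists_prim_root R[i] K K0.
have w1 : cabs w = 1.
  have := congr1 (@cabs R) (prim_expr_order pw); rewrite cabsX cabs1 => h.
  by apply/eqP; rewrite -(@pexpr_eq1 _ _ K) ?cabs_ge0 // h.
have w0 : w != 0 by rewrite -cabs_gt0 w1.
pose z j : R[i] := (r%:C)%C * w ^+ j.
have zr j : cabs (z j) = r.
  by rewrite cabsM cabs_real cabsX w1 expr1n mulr1 gtr0_norm.
(* Discrete Fourier inversion over the [K] points [r w^j]. Only the phase [w^(j n)] is divided out,
   so the factor [r ^+ n] remains. *)
have -> : ((r ^+ n)%:C)%C *: u n = K%:R^-1 *:
    (\sum_(j < K) (w ^+ j) ^- n *: \sum_(0 <= k < K) z j ^+ k *: u k).
  under eq_bigr do rewrite scaler_sumr big_mkord.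
  rewrite exchange_big /= (bigD1 (Ordinal nK)) //= [X in _ + X]big1.
    rewrite addr0; under eq_bigr do rewrite scalerA.
    rewrite -scaler_suml scalerA; congr (_ *: _).
    rewrite (eq_bigr (fun i : 'I_K => (w ^+ i) ^+ n / (w ^+ i) ^+ n * ((r ^+ n)%:C)%C)); last first.
      by move=> i _; rewrite /z exprMn rmorphXn /=; ring.
    rewrite -mulr_suml (sum_prim_root_pow pw) // eqxx mulrA mulVf ?mul1r //.
    by rewrite pnatr_eq0 -lt0n.
  move=> k kn; under eq_bigr do rewrite scalerA.
  rewrite -scaler_suml.
  rewrite (eq_bigr (fun i : 'I_K => (w ^+ i) ^+ k / (w ^+ i) ^+ n * ((r ^+ k)%:C)%C)); last first.
      by move=> i _; rewrite /z exprMn rmorphXn /=; ring.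
  rewrite -mulr_suml (sum_prim_root_pow pw) // ifN ?mul0r ?scale0r //.
have -> : x = cabs (K%:R^-1 : R[i]) * (K%:R * x).
  by rewrite cabsV cabs_nat mulrA mulVf ?mul1r // pnatr_eq0 -lt0n.
apply: BdZ; apply: Bd_sum => j.
rewrite -[x]mul1r; have {1}-> : 1 = cabs ((w ^+ j) ^- n).
  by rewrite cabsV !cabsX w1 !expr1n invr1.
by apply: BdZ; exact: Bz.
Qed.

(** Boundedness of the powers of [r T]. The argument pushes [r] from [c0^-1] up to 1 and then
    beyond. *)
Let P (r C : R) := forall v (x : R), S v -> 0 <= x -> Bd v x ->
  forall n, Bd (((r ^+ n)%:C)%C *: iter n T v) (C * x).

Let Bdq r C z n v x : P r C -> cabs z = r -> S v -> 0 <= x -> Bd v x ->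
  Bd (q z n v) (C * x).
Proof.
move=> Pr zr Sv x0 vx; have [z0|z0] := eqVneq z 0.
  have := Pr v x Sv x0 vx n; rewrite /q -zr z0 cabs0.
  by case: n => [|n]; rewrite ?expr0 // exprS mul0r [in X in _ -> X]exprS mul0r.
have -> : q z n v = (z ^+ n / ((r ^+ n)%:C)%C) *: (((r ^+ n)%:C)%C *: iter n T v).
  rewrite scalerA divfK // rmorphXn expf_neq0 //= -zr -cabs_gt0 cabs_real.
  by rewrite ger0_norm ?cabs_ge0 // cabs_gt0.
rewrite -[C * x]mul1r; have {1}-> : 1 = cabs (z ^+ n / ((r ^+ n)%:C)%C).
  rewrite cabsM cabsV cabs_real cabsX -zr ger0_norm ?exprn_ge0 ?cabs_ge0 //.
  by rewrite divff // expf_neq0 // gt_eqF // cabs_gt0.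
by apply: BdZ; apply: Pr.
Qed.

Let Sq z k v : S v -> S (q z k v).
Proof. by move=> Sv; apply: SZ; apply: Siter. Qed.

(** With constant weights, Abel summation telescopes to [v - q z K v]; the bound obtained is uniform
    in [K]. *)
Let Bd_geom r C z K v x : P r C -> 0 <= C -> r <= 1 -> cabs z = r -> S v ->
  0 <= x -> Bd v x -> Bd (\sum_(0 <= k < K) q z k v) (M * (1 + C) * x).
Proof.
move=> Pr C0 r1 zr Sv x0 vx; rewrite -mulrA; apply: (@BdR z).
- by rewrite zr.
- by apply: Ssum => k; exact: Sq.
- by rewrite mulr_ge0 ?addr_ge0.
have := abel z (fun=> 1) K v; rewrite /= [X in _ *: _ + X]big1 => [|k _]; last first.
  by rewrite subrr scale0r.
under eq_bigr do rewrite scale1r.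
rewrite addr0 !scale1r => ->; rewrite mulrDl mul1r.
by apply: BdB => //; exact: Bdq Pr _ _ _ _.
Qed.

Let Bd_slice r C z a b v x : (a <= b)%N -> P r C -> 0 <= C -> r <= 1 ->
  cabs z = r -> S v -> 0 <= x -> Bd v x ->
  Bd (\sum_(a <= k < b) q z k v) (2 * M * (1 + C) * x).
Proof.
move=> ab Pr C0 r1 zr Sv x0 vx.
have -> : \sum_(a <= k < b) q z k v =
    \sum_(0 <= k < b) q z k v - \sum_(0 <= k < a) q z k v.
  by rewrite (@big_cat_nat _ _ _ a 0 b) //= addrAC subrr add0r.
have -> : 2 * M * (1 + C) * x = M * (1 + C) * x + M * (1 + C) * x by ring.
by apply: BdB; exact: Bd_geom Pr _ _ _ _ _ _.
Qed.

Let Sw z (w : nat -> R[i]) K v : S v -> S (\sum_(0 <= k < K) w k *: q z k v).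
Proof. by move=> Sv; apply: Ssum => k; apply: SZ; apply: Sq. Qed.

(* Fejer weights make the constant independent of the one assumed. *)
Let P_unif r C : 0 < r -> r <= 1 -> 0 <= C -> P r C -> P r M.
Proof.
move=> r0 r1 C0 Pr v x Sv x0 vx n; apply: Bd_lim => e e0.
set D := M * ((n.+1)%:R + 2 * M * (1 + C)) * x.
have M0 : 0 <= M by apply: le_trans M_ge1.
have D0 : 0 <= D by rewrite !mulr_ge0 // !addr_ge0 // !mulr_ge0 // addr_ge0.
(* [C] enters only through [D], and [D / j] falls below [e] for large [j]. *)
have [j jD] : exists j : nat, D / e < j%:R.
  by exists (Num.truncn (D / e)).+1; rewrite truncnS_gt.
have j0 : (0 < j)%N by rewrite -(ltr_nat R) (le_lt_trans _ jD) // divr_ge0 // ltW.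
have j0R : 0 < j%:R :> R by rewrite ltr0n.
have jC : (j%:R : R[i]) != 0 by rewrite pnatr_eq0 -lt0n.
pose K := (n + j)%N.
have nK : (n < K)%N by rewrite -[X in (X < _)%N]addn0 ltn_add2l.
(* The weight [K - k] equals [j] at index [n]. Abel summation leaves [K + 1] copies of [v] minus a
   plain Neumann sum; since [K + 1 = n + 1 + j], division by [j] yields [M * x + D / j]. *)
pose u k := ((K - k)%N%:R : R[i]) *: iter k T v.
have Bu : Bd (((r ^+ n)%:C)%C *: u n) (M * (K.+1%:R * x + 2 * M * (1 + C) * x)).
  apply: (@cauchy K) => // z zr.
  under eq_bigr do rewrite /u scalerA mulrC -scalerA.
  apply: (@BdR z); [by rewrite zr|exact: (Sw z (fun k => (K - k)%N%:R))|..].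
    by rewrite addr_ge0 ?mulr_ge0 // addr_ge0.
  rewrite (abel z (fun k => (K - k)%N%:R)) subnn scale0r subr0 subn0.
  have -> : \sum_(0 <= k < K) ((K - k.+1)%N%:R - (K - k)%N%:R : R[i]) *: q z k.+1 v
     = v - \sum_(0 <= k < K.+1) q z k v.
    rewrite [in RHS]big_nat_recl // [q z 0%N v]scale1r opprD addrA subrr add0r.
    rewrite -sumrN; apply: eq_big_nat => k /andP[_ kK].
    rewrite -[(K - k)%N]prednK ?subn_gt0 // -subnS -natr1 opprD addrA subrr add0r.
    by rewrite scaleN1r.
  rewrite addrA -[X in _ + X - _]scale1r -scalerDl natr1; apply: BdB.
    by rewrite -(cabs_nat R); exact: BdZ.
  exact: Bd_slice Pr _ _ _ _ _ _.
have -> : ((r ^+ n)%:C)%C *: iter n T v = j%:R^-1 *: (((r ^+ n)%:C)%C *: u n).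
  rewrite /u /K addnC addnK !scalerA mulrA [in RHS]mulrAC mulVf ?mul1r //.
apply: Bd_le (BdZ j%:R^-1 Bu); rewrite cabsV cabs_nat.
have -> : M * (K.+1%:R * x + 2 * M * (1 + C) * x) = j%:R * (M * x) + D.
  by rewrite /D /K -addnS natrD; ring.
rewrite mulrDr mulrA mulVf ?gt_eqF // mul1r lerD2l mulrC ler_pdivrMr //.
by rewrite mulrC -ler_pdivrMr // ltW.
Qed.

(* Tent weights: the resolvent is bounded on the circle, hence so is its square,
   whose coefficients carry an extra factor [n]. *)
Let P_tent r n : 0 < r -> r <= 1 -> P r M ->
  forall v (x : R), S v -> 0 <= x -> Bd v x ->
  Bd (((r ^+ n)%:C)%C *: (n%:R *: iter n T v)) (4 * M ^+ 2 * (1 + M) * x).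
Proof.
move=> r0 r1 Pr v x Sv x0 vx; have M0 : 0 <= M by apply: le_trans M_ge1.
case: n => [|n].
  rewrite scale0r scaler0; apply: Bd_le Bd0.
  by rewrite !mulr_ge0 ?exprn_ge0 // addr_ge0.
(* The tent peaks at index [n.+1], half of [K], with value [n.+1]. Its increments are 1 before the
   peak and -1 after it, so Abel summation leaves two slices of the Neumann series. *)
pose K := (n.+1 + n.+1)%N.
pose w k := (minn k (K - k))%:R : R[i].
have nK : (n.+1 < K)%N by rewrite /K; lia.
pose u k := w k *: iter k T v.
have -> : n.+1%:R *: iter n.+1 T v = u n.+1.
  by rewrite /u /w /K addnK minnn.
apply: (@cauchy K) => // z zr.
under eq_bigr do rewrite /u scalerA mulrC -scalerA.
have -> : 4 * M ^+ 2 * (1 + M) * x =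
   M * (2 * M * (1 + M) * x + 2 * M * (1 + M) * x) by ring.
apply: (@BdR z); [by rewrite zr|exact: (Sw z w)|..].
  by rewrite addr_ge0 ?mulr_ge0 // addr_ge0.
rewrite (abel z w) /w min0n subnn minn0 !scale0r subr0 add0r.
rewrite (@big_cat_nat _ _ _ n.+1 0 K) ?leq_addl //=.
have -> : \sum_(0 <= k < n.+1)
    ((minn k.+1 (K - k.+1))%:R - (minn k (K - k))%:R : R[i]) *: q z k.+1 v =
    \sum_(1 <= k < n.+2) q z k v.
  rewrite [RHS]big_add1 /=; apply: eq_big_nat => k /andP[_ kn].
  rewrite (minn_idPl _) ?(minn_idPl _) ?leq_subRL /K; try lia.
  by rewrite -natr1 addrAC subrr add0r scale1r.
have -> : \sum_(n.+1 <= k < K)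
    ((minn k.+1 (K - k.+1))%:R - (minn k (K - k))%:R : R[i]) *: q z k.+1 v =
    - \sum_(n.+2 <= k < K.+1) q z k v.
  rewrite [in RHS]big_add1 -sumrN /=; apply: eq_big_nat => k /andP[nk kK].
  rewrite (minn_idPr _) ?(minn_idPr _) ?leq_subLR /K; try lia.
  rewrite -[(n.+1 + n.+1 - k)%N]prednK ?subn_gt0 // -subnS -natr1 opprD addrA.
  by rewrite subrr add0r scaleN1r.
by apply: BdB; apply: (Bd_slice (r := r)) => //; rewrite /K; lia.
Qed.

(** The factor [n] in the tent estimate makes the [m]-th power of [r T] at most one half in norm for
    an [m] depending on [M] alone. Hence each admissible radius can be enlarged by the same factor
    [g], and finitely many enlargements cross the unit circle. *)
Lemma power_decay : exists C g : R, [/\ 0 < C, 1 < g &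
  forall v (x : R), S v -> 0 <= x -> Bd v x ->
  forall n, Bd (iter n T v) (C * g ^- n * x)].
Proof.
have M0 : 0 < M by apply: lt_le_trans M_ge1.
set M' := 4 * M ^+ 2 * (1 + M).
have M'0 : 0 <= M' by rewrite !mulr_ge0 ?exprn_ge0 ?addr_ge0 // ltW.
have [m mM m0N] : exists2 m : nat, 2 * M' <= m%:R & (0 < m)%N.
  by exists (Num.truncn (2 * M')).+1; rewrite // ltW // truncnS_gt.
have m0 : 0 < m%:R :> R by rewrite ltr0n.
(* Chosen so that [g ^+ m = 2] absorbs the one half gained at the power [m]. *)
pose g : R := 2 `^ (m%:R^-1).
have gm : g ^+ m = 2.
  by rewrite /g -powR_mulrn ?powR_ge0 // -powRrM mulVf ?gt_eqF // powRr1.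
have g1 : 1 < g.
  rewrite ltNge; apply/negP => gle.
  have : g ^+ m <= 1 by rewrite exprn_ile1 // powR_ge0.
  by rewrite gm; lra.
have gi i : (i <= m)%N -> g ^+ i <= 2.
  by move=> im; rewrite -gm ler_weXn2l // ltW.
have gain r C : 0 < r -> r <= 1 -> 0 <= C -> P r C -> P (r * g) (2 * M).
  move=> r0 r1 C0 /(P_unif r0 r1 C0) Pr v x Sv x0 vx n.
  have half y w : S w -> 0 <= y -> Bd w y ->
      Bd ((((r * g) ^+ m)%:C)%C *: iter m T w) y.
    move=> Sw' y0 wy; have := P_tent m r0 r1 Pr Sw' y0 wy.
    move=> /(BdZ ((2 / m%:R)%:C)%C); rewrite cabs_real ger0_norm; last first.
      by rewrite divr_ge0 // ltW.
    rewrite scalerA scalerA exprMn gm -/M' => h.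
    have -> : ((r ^+ m * 2)%:C)%C = ((2 / m%:R)%:C * (r ^+ m)%:C * m%:R)%C :> R[i].
      rewrite -(rmorph_nat (real_complex R)) -!rmorphM /=; congr (_%:C)%C.
      by field; rewrite gt_eqF.
    apply: Bd_le h; rewrite mulrA -[leRHS]mul1r ler_wpM2r //.
    by rewrite mulrAC ler_pdivrMr // mul1r.
  (* Each block of [m] steps costs at most a factor 1, by [half]; the remaining fewer than [m] steps
     cost at most [M * 2]. *)
  rewrite (divn_eq n m) addnC; elim: (n %/ m)%N => [|j IH].
    rewrite mul0n addn0; have := Pr v x Sv x0 vx (n %% m)%N.
    move=> /(BdZ ((g ^+ (n %% m))%:C)%C); rewrite cabs_real ger0_norm; last first.
      by rewrite exprn_ge0 // powR_ge0.
    rewrite scalerA -rmorphM -exprMn [g * r]mulrC; apply: Bd_le.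
    by rewrite mulrA ler_wpM2r // ler_wpM2r ?(ltW M0) // gi // ltnW // ltn_pmod.
  rewrite mulSn addnCA exprD iterD rmorphM /= -scalerA.
  rewrite -iterZ.
  apply: half IH; first by apply: SZ; exact: Siter.
  by rewrite !mulr_ge0 // ltW.
have c00 : 0 < c0 by apply: lt_le_trans c0_ge1.
have M20 : 0 <= 2 * M by rewrite mulr_ge0 // ltW.
have mono r r' C : 0 <= C -> 0 <= r' -> r' <= r -> 0 < r -> P r C -> P r' C.
  move=> C0 r'0 r'r r0 Pr v x Sv x0 vx n.
  have := Pr v x Sv x0 vx n => /(BdZ (((r' / r) ^+ n)%:C)%C).
  rewrite scalerA -rmorphM -exprMn divfK ?gt_eqF //; apply: Bd_le.
  rewrite cabs_real ger0_norm ?exprn_ge0 ?divr_ge0 ?(ltW r0) //.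
  rewrite -[leRHS]mul1r ler_wpM2r ?mulr_ge0 // exprn_ile1 ?divr_ge0 ?(ltW r0) //.
  by rewrite ler_pdivrMr // mul1r.
(* The start [c0^-1] comes from the crude growth bound [c0 ^+ n]. The cap at 1 keeps the radius
   where the resolvent bound holds. *)
have step j : P (Num.min 1 (c0^-1 * g ^+ j)) (2 * M).
  elim: j => [|j IH].
    rewrite expr0 mulr1 (min_idPr _) ?invf_le1 //.
    move=> v x Sv x0 vx n.
    have -> : 2 * M * x = cabs ((c0^-1 ^+ n)%:C)%C * (c0 ^+ n * (2 * M * x)).
      rewrite cabs_real ger0_norm ?exprn_ge0 ?invr_ge0 ?(ltW c00) //.
      by rewrite mulrA -exprMn mulVf ?gt_eqF // expr1n mul1r.
    apply: BdZ; apply: (@Bd_le _ (c0 ^+ n * x)).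
      rewrite ler_wpM2l ?exprn_ge0 ?(ltW c00) // -[leLHS]mul1r ler_wpM2r //.
      by rewrite (le_trans M_ge1) // ler_peMl ?(ltW M0) // ler1n.
    elim: n => [|n IH] /=; first by rewrite mul1r.
    rewrite exprS -mulrA; apply: BdT => //; first exact: Siter.
    by rewrite mulr_ge0 // exprn_ge0 // ltW.
  have r0 : 0 < Num.min 1 (c0^-1 * g ^+ j).
    by rewrite lt_min ltr01 /= mulr_gt0 ?invr_gt0 ?exprn_gt0 // powR_gt0.
  apply: mono (gain _ _ r0 _ M20 IH) => //.
  - by rewrite le_min ler01 /= mulr_ge0 ?invr_ge0 ?exprn_ge0 ?powR_ge0 // ltW.
  - rewrite exprSr mulrA minr_pMl ?powR_ge0 // mul1r.
    by rewrite le_min !ge_min lexx (ltW g1) !orbT.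
  - by rewrite mulr_gt0 // powR_gt0.
  - by rewrite ge_min lexx.
(* Bernoulli's inequality for [1 + (g - 1)]. *)
have [j jg] : exists j, 1 <= c0^-1 * g ^+ j.
  have g10 : 0 < g - 1 by rewrite subr_gt0.
  exists (Num.truncn (c0 / (g - 1))).+1; set j := (_.+1).
  have jb : c0 / (g - 1) <= j%:R by rewrite ltW // truncnS_gt.
  rewrite mulrC ler_pdivlMr // mul1r (@le_trans _ _ (1 + (g - 1) *+ j)) //.
    by rewrite -mulr_natl; move: jb; rewrite ler_pdivrMr //; lra.
  elim: j {jb} => [|j IH]; first by rewrite addr0.
  rewrite exprS mulrSr; apply: (@le_trans _ _ (g * (1 + (g - 1) *+ j))).
    have : 0 <= (g - 1) *+ j by rewrite mulrn_wge0 // ltW.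
    by nra.
  by rewrite ler_wpM2l // powR_ge0.
have P1 : P 1 (2 * M) by have := step j; rewrite (min_idPl _).
(* One more gain, from radius 1 itself, gives a radius [g] larger than 1. *)
have Pg := gain _ _ ltr01 (lexx _) M20 P1.
exists (2 * M), g; split => // [|v x Sv x0 vx n]; first by rewrite mulr_gt0.
have g0 : 0 < g by apply: lt_trans g1.
have := Pg v x Sv x0 vx n => /(BdZ ((g ^- n)%:C)%C).
rewrite mul1r scalerA -rmorphM mulVf ?expf_neq0 ?gt_eqF // scale1r cabs_real.
rewrite ger0_norm ?invr_ge0 ?exprn_ge0 ?(ltW g0) //.
by rewrite mulrA [2 * M * _]mulrC.
Qed.

End PowerDecay.

(** * Complex-valued functions of a real variable *)

Section ComplexValued.
Variable R : realType.
Implicit Types (z w c : R[i]) (f g : R -> R[i]).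

Lemma ReM z w : complex.Re (z * w) =
  complex.Re z * complex.Re w - complex.Im z * complex.Im w.
Proof. by case: z w => [? ?] [? ?]. Qed.

Lemma ImM z w : complex.Im (z * w) =
  complex.Re z * complex.Im w + complex.Im z * complex.Re w.
Proof. by case: z w => [? ?] [? ?]. Qed.

Lemma ReD z w : complex.Re (z + w) = complex.Re z + complex.Re w.
Proof. by case: z w => [? ?] [? ?]. Qed.

Lemma ImD z w : complex.Im (z + w) = complex.Im z + complex.Im w.
Proof. by case: z w => [? ?] [? ?]. Qed.

Lemma ReN z : complex.Re (- z) = - complex.Re z.
Proof. by case: z => [? ?]. Qed.

Lemma ImN z : complex.Im (- z) = - complex.Im z.
Proof. by case: z => [? ?]. Qed.

Lemma eq_ReIm z w : complex.Re z = complex.Re w ->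
  complex.Im z = complex.Im w -> z = w.
Proof. by case: z w => [? ?] [? ?] /= -> ->. Qed.

Lemma cexpE z : cexp z = (expR (complex.Re z) * cos (complex.Im z) +i*
  (expR (complex.Re z) * sin (complex.Im z)))%C.
Proof. by apply: eq_ReIm; rewrite ?ReM ?ImM /=; ring. Qed.

Lemma cexpD z w : cexp (z + w) = cexp z * cexp w.
Proof.
rewrite !cexpE ReD ImD expRD cosD sinD.
by apply: eq_ReIm; rewrite ?ReM ?ImM /=; ring.
Qed.

Lemma cexp0 : cexp (0 : R[i]) = 1.
Proof. by rewrite cexpE /= expR0 cos0 sin0 mulr0 mulr1. Qed.

Lemma cexpK z : cexp z * cexp (- z) = 1.
Proof. by rewrite -cexpD subrr cexp0. Qed.

Lemma cabs_cexp z : cabs (cexp z) = expR (complex.Re z).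
Proof.
rewrite cexpE /cabs /= !exprMn -mulrDr cos2Dsin2 mulr1 sqrtr_sqr.
by rewrite ger0_norm ?expR_ge0.
Qed.

(** Polar form: the logarithm of the modulus, with [acos] as angle, negated when the imaginary part
    is negative. *)
Lemma cexp_surj z : z != 0 -> exists w, cexp w = z.
Proof.
rewrite -cabs_gt0 => z0.
pose x := complex.Re z / cabs z; pose y := complex.Im z / cabs z.
have xy : x ^+ 2 + y ^+ 2 = 1.
  rewrite !exprMn -mulrDl exprVn /cabs sqr_sqrtr ?addr_ge0 ?sqr_ge0 //.
  rewrite divff // gt_eqF // -[ltRHS]sqr_sqrtr ?addr_ge0 ?sqr_ge0 //.
  by rewrite exprn_gt0.
have x1 : -1 <= x <= 1.
  rewrite -ler_norml -(@ler_pXn2r _ 2%N) ?nnegrE // expr1n real_normK ?num_real //.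
  by rewrite -xy lerDl sqr_ge0.
have [t [ct st]] : exists t : R, cos t = x /\ sin t = y.
  have s2 : Num.sqrt (1 - x ^+ 2) = `|y|.
    by rewrite -xy [_ + y ^+ 2]addrC addrK sqrtr_sqr.
  have [y0|y0] := leP 0 y.
    by exists (acos x); rewrite acosK // sin_acos // s2 ger0_norm.
  exists (- acos x); rewrite cosN sinN acosK // sin_acos // s2.
  by rewrite ltr0_norm // opprK.
exists (ln (cabs z) +i* t)%C; rewrite cexpE /= lnK // ct st.
by apply: eq_ReIm; rewrite /= mulrC divfK // gt_eqF.
Qed.

(** Stated over any topological space, so that the same closure rules serve subspaces of [R] and the
    plane [R * R]. *)
Definition ccont (T : topologicalType) (f : T -> R[i]) : Prop :=
  continuous (fun x => complex.Re (f x)) /\ continuous (fun x => complex.Im (f x)).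

Lemma ccont_cst (T : topologicalType) c : ccont (fun _ : T => c).
Proof. by split=> x; exact: cvg_cst. Qed.

Lemma ccontD (T : topologicalType) (f g : T -> R[i]) :
  ccont f -> ccont g -> ccont (fun x => f x + g x).
Proof.
move=> [f1 f2] [g1 g2]; split.
  under [X in continuous X]funext do rewrite ReD.
  by move=> x; apply: cvgD; [exact: f1|exact: g1].
under [X in continuous X]funext do rewrite ImD.
by move=> x; apply: cvgD; [exact: f2|exact: g2].
Qed.

Lemma ccontM (T : topologicalType) (f g : T -> R[i]) :
  ccont f -> ccont g -> ccont (fun x => f x * g x).
Proof.
move=> [f1 f2] [g1 g2]; split.
  under [X in continuous X]funext do rewrite ReM.
  by move=> x; apply: cvgB; apply: cvgM; [exact: f1|exact: g1|exact: f2|exact: g2].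
under [X in continuous X]funext do rewrite ImM.
by move=> x; apply: cvgD; apply: cvgM; [exact: f1|exact: g2|exact: f2|exact: g1].
Qed.

Lemma ccont_cexp (T : topologicalType) (f : T -> R[i]) :
  ccont f -> ccont (fun x => cexp (f x)).
Proof.
move=> [f1 f2]; split.
  under [X in continuous X]funext do rewrite cexpE /=.
  move=> x; apply: cvgM.
    by apply: continuous_cvg; [exact: continuous_expR|exact: f1].
  by apply: continuous_cvg; [exact: continuous_cos|exact: f2].
under [X in continuous X]funext do rewrite cexpE /=.
move=> x; apply: cvgM.
  by apply: continuous_cvg; [exact: continuous_expR|exact: f1].
by apply: continuous_cvg; [exact: continuous_sin|exact: f2].
Qed.

Lemma ccont_sum (T : topologicalType) (I : Type) (r : seq I) (P : pred I)
  (F : I -> T -> R[i]) :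
  (forall i, ccont (F i)) -> ccont (fun x => \sum_(i <- r | P i) F i x).
Proof.
move=> cF; elim: r => [|i r IH].
  by under [X in ccont X]funext do rewrite big_nil; exact: ccont_cst.
under [X in ccont X]funext do rewrite big_cons.
by case: (P i) => //; exact: ccontD.
Qed.

Lemma ccont_cabs (T : topologicalType) (f : T -> R[i]) :
  ccont f -> continuous (fun x => cabs (f x)).
Proof.
move=> [f1 f2] x; apply: (@cvg_comp _ _ _ _ Num.sqrt _
  (nbhs (complex.Re (f x) ^+ 2 + complex.Im (f x) ^+ 2))); last exact: sqrt_continuous.
by apply: cvgD; rewrite expr2; apply: cvgM; [exact: f1|exact: f1|exact: f2|exact: f2].
Qed.

Definition cderiv f (t : R) (d : R[i]) : Prop :=
  is_derive t 1 (fun s => complex.Re (f s)) (complex.Re d) /\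
  is_derive t 1 (fun s => complex.Im (f s)) (complex.Im d).

Lemma cderiv_cst c t : cderiv (fun=> c) t 0.
Proof. by split; exact: is_derive_cst. Qed.

Lemma cderivD f g t d e : cderiv f t d -> cderiv g t e ->
  cderiv (fun s => f s + g s) t (d + e).
Proof.
move=> [f1 f2] [g1 g2]; split.
  rewrite ReD; under [X in is_derive _ _ X _]funext do rewrite ReD.
  exact: is_deriveD.
rewrite ImD; under [X in is_derive _ _ X _]funext do rewrite ImD.
exact: is_deriveD.
Qed.

Lemma cderivM f g t d e : cderiv f t d -> cderiv g t e ->
  cderiv (fun s => f s * g s) t (d * g t + f t * e).
Proof.
move=> [f1 f2] [g1 g2]; split.
  under [X in is_derive _ _ X _]funext do rewrite ReM.
  by apply: is_derive_eq; rewrite ReD !ReM /GRing.scale /=; ring.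
under [X in is_derive _ _ X _]funext do rewrite ImM.
by apply: is_derive_eq; rewrite ImD !ImM /GRing.scale /=; ring.
Qed.

Lemma cderivZ c f t d : cderiv f t d -> cderiv (fun s => c * f s) t (c * d).
Proof.
by move=> fd; have := cderivM (cderiv_cst c t) fd; rewrite mul0r add0r.
Qed.

Lemma cderiv_sum (I : Type) (r : seq I) (P : pred I) (F : I -> R -> R[i]) t
  (d : I -> R[i]) : (forall i, P i -> cderiv (F i) t (d i)) ->
  cderiv (fun s => \sum_(i <- r | P i) F i s) t (\sum_(i <- r | P i) d i).
Proof.
move=> cF; elim: r => [|i r IH].
  under [X in cderiv X]funext do rewrite big_nil.
  by rewrite big_nil; exact: cderiv_cst.
under [X in cderiv X]funext do rewrite big_cons.
by rewrite big_cons; case: ifP => // Pi; apply: cderivD => //; exact: cF.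
Qed.

Lemma cderiv_unique f t d e : cderiv f t d -> cderiv f t e -> d = e.
Proof.
move=> [d1 d2] [e1 e2]; apply: eq_ReIm.
  by rewrite -(@derive_val _ _ _ _ _ _ _ d1) (@derive_val _ _ _ _ _ _ _ e1).
by rewrite -(@derive_val _ _ _ _ _ _ _ d2) (@derive_val _ _ _ _ _ _ _ e2).
Qed.

Lemma cderiv_eq_itv f g (a b t : R) d : a < t < b ->
  (forall s, a < s < b -> f s = g s) -> cderiv f t d -> cderiv g t d.
Proof.
move=> tab fg [f1 f2].
have tn : \forall s \near t, f s = g s.
  have := @near_in_itvoo _ a b t; rewrite in_itv /= => /(_ tab).
  by apply: filterS => s; rewrite in_itv /=; exact: fg.
by split; [apply: near_eq_is_derive f1|apply: near_eq_is_derive f2]; apply: filterS tn => s ->.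
Qed.

Lemma cderiv_shift f (h t : R) d :
  cderiv f (t + h) d -> cderiv (fun s => f (s + h)) t d.
Proof.
have H (k : R -> R) e : is_derive (t + h) 1 k e -> is_derive t 1 (fun s => k (s + h)) e.
  by move=> kd; apply: is_derive_eq; rewrite addr0 mulr1.
by move=> [f1 f2]; split; exact: H.
Qed.

Lemma cderiv_cexp_lin c (a t : R) :
  cderiv (fun s => cexp (c * ((s - a)%:C)%C)) t (c * cexp (c * ((t - a)%:C)%C)).
Proof.
have lin (p : R) : is_derive t 1 (fun s : R => p * (s - a)) p.
  by apply: is_derive_eq; rewrite /GRing.scale /=; ring.
have E s : cexp (c * ((s - a)%:C)%C) =
    (expR (complex.Re c * (s - a)) * cos (complex.Im c * (s - a)) +i*
     (expR (complex.Re c * (s - a)) * sin (complex.Im c * (s - a))))%C.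
  by rewrite cexpE ReM ImM /= !mulr0 subr0 add0r.
have de : is_derive t 1 (fun s => expR (complex.Re c * (s - a)))
    (expR (complex.Re c * (t - a)) * complex.Re c).
  exact: (@is_derive1_comp _ (@expR R) (fun s => complex.Re c * (s - a))).
have dc : is_derive t 1 (fun s => cos (complex.Im c * (s - a)))
    (- sin (complex.Im c * (t - a)) * complex.Im c).
  exact: (@is_derive1_comp _ (@cos R) (fun s => complex.Im c * (s - a))).
have ds : is_derive t 1 (fun s => sin (complex.Im c * (s - a)))
    (cos (complex.Im c * (t - a)) * complex.Im c).
  exact: (@is_derive1_comp _ (@sin R) (fun s => complex.Im c * (s - a))).
have -> : (fun s => cexp (c * ((s - a)%:C)%C)) = (fun s =>
    (expR (complex.Re c * (s - a)) * cos (complex.Im c * (s - a)) +i*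
     (expR (complex.Re c * (s - a)) * sin (complex.Im c * (s - a))))%C).
  exact/funext.
split; rewrite E ?ReM ?ImM /=.
  by apply: is_derive_eq; rewrite /GRing.scale /=; ring.
by apply: is_derive_eq; rewrite /GRing.scale /=; ring.
Qed.

(** The mean value theorem is applied to real and imaginary parts separately, whence the factor
    2. *)
Lemma mean_value_bound (f df : R -> R[i]) (a b K : R) : a <= b ->
  ccont (f : subspace [set s | a <= s <= b] -> R[i]) ->
  (forall s, a < s < b -> cderiv f s (df s)) ->
  (forall s, a < s < b -> cabs (df s) <= K) ->
  cabs (f b - f a) <= 2 * K * (b - a).
Proof.
have E : [set s | a <= s <= b] = `[a, b].
  by rewrite set_itvcc.
rewrite le_eqVlt => /predU1P[->|ab].
  by rewrite !subrr mulr0 cabs0.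
rewrite E => -[c1 c2] fd fK.
have H (h dh : R -> R) : {within `[a, b], continuous h} ->
    (forall s, a < s < b -> is_derive s 1 h (dh s)) ->
    (forall s, a < s < b -> `|dh s| <= K) -> `|h b - h a| <= K * (b - a).
  move=> ch hd hK.
  have hd' s : s \in `]a, b[%R -> is_derive s 1 h (dh s).
    by rewrite in_itv /=; exact: hd.
  have [s sab ->] := MVT ab hd' ch.
  rewrite normrM [`|b - a|]ger0_norm ?subr_ge0 ?(ltW ab) //.
  rewrite ler_wpM2r ?subr_ge0 ?(ltW ab) //; apply: hK.
  by move: sab; rewrite in_itv.
have R1 := H _ (fun s => complex.Re (df s)) c1 (fun s sab => (fd s sab).1)
  (fun s sab => le_trans (cabs_Re _) (fK s sab)).
have R2 := H _ (fun s => complex.Im (df s)) c2 (fun s sab => (fd s sab).2)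
  (fun s sab => le_trans (cabs_Im _) (fK s sab)).
rewrite (le_trans (cabs_ReIm _)) // ReD ImD ReN ImN.
by rewrite -mulrA mulr2n mulrDl mul1r lerD.
Qed.

Lemma Re_mul_real_le z (x y L : R) : 0 <= x <= y -> cabs z <= L ->
  complex.Re (z * (x%:C)%C) <= L * y.
Proof.
move=> /andP[x0 xy] zL; rewrite ReM /= mulr0 subr0.
apply: (@le_trans _ _ (L * x)).
  by rewrite ler_wpM2r // (le_trans (ler_norm _)) // (le_trans (cabs_Re _)).
by rewrite ler_wpM2l // (le_trans (cabs_ge0 _) zL).
Qed.

(* Integrating factor [cexp (- c (s - a))]. *)
Lemma variation_of_constants (f k : R -> R[i]) (c : R[i]) (a b K L : R) : a <= b ->
  ccont (f : subspace [set s | a <= s <= b] -> R[i]) ->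
  (forall s, a < s < b -> cderiv f s (c * f s + k s)) ->
  (forall s, a < s < b -> cabs (k s) <= K) -> 0 <= K -> cabs c <= L ->
  forall s, a <= s <= b ->
  cabs (f s - cexp (c * ((s - a)%:C)%C) * f a) <=
    2 * expR (L * (b - a)) ^+ 2 * (b - a) * K.
Proof.
move=> ab cf fd kK K0 cL s /andP[as_ sb].
pose u t := cexp (- c * ((t - a)%:C)%C) * f t.
have -> : f s - cexp (c * ((s - a)%:C)%C) * f a =
    cexp (c * ((s - a)%:C)%C) * (u s - u a).
  by rewrite /u subrr mulr0 cexp0 mul1r mulrBr mulrA mulNr cexpK mul1r.
(* The same constant bounds the inverse exponential inside [u], which explains the square in the
   estimate. *)
have e1 : cabs (cexp (c * ((s - a)%:C)%C)) <= expR (L * (b - a)).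
  by rewrite cabs_cexp ler_expR Re_mul_real_le // subr_ge0 as_ lerD2r.
rewrite cabsM; apply: (@le_trans _ _
    (expR (L * (b - a)) * (2 * (expR (L * (b - a)) * K) * (b - a)))); last first.
  by rewrite le_eqVlt; apply/orP; left; apply/eqP; ring.
apply: ler_pM => //; try exact: cabs_ge0.
apply: (@le_trans _ _ (2 * (expR (L * (b - a)) * K) * (s - a))); last first.
  by rewrite ler_wpM2l ?lerD2r // !mulr_ge0 // expR_ge0.
apply: (@mean_value_bound u (fun t => cexp (- c * ((t - a)%:C)%C) * k t)) => //.
- apply: ccontM; last first.
    have sub : [set t | a <= t <= s] `<=` [set t | a <= t <= b].
      by move=> t /= /andP[-> ts] /=; rewrite (le_trans ts).
    by case: cf => c1 c2; split; [exact: continuous_subspaceW c1|exact: continuous_subspaceW c2].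
  have [h1 h2] : ccont (fun t : R => cexp (- c * ((t - a)%:C)%C)).
    apply: ccont_cexp; apply: ccontM; first exact: ccont_cst.
    split => /= x; last exact: cvg_cst.
    by apply: cvgB; [exact: cvg_id|exact: cvg_cst].
  by split; exact: continuous_subspaceT.
- move=> t /andP[at_ ts].
  have tab : a < t < b by rewrite at_ (lt_le_trans ts).
  have := cderivM (cderiv_cexp_lin (- c) a t) (fd t tab).
  by congr cderiv; ring.
- move=> t /andP[at_ ts].
  have tab : a < t < b by rewrite at_ (lt_le_trans ts).
  rewrite cabsM ler_pM ?cabs_ge0 ?kK // cabs_cexp ler_expR Re_mul_real_le ?cabsN //.
  by rewrite subr_ge0 lerD2r ltW //= ltW // (lt_le_trans ts).
Qed.

(** The modulus attains a nonzero minimum on the compact disc. Continuity of [F] is phrased through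
    composition, so that it can be used on the disc seen inside [R * R]. *)
Lemma disc_lower_bound (F : R[i] -> R[i]) :
  (forall (T : topologicalType) (f : T -> R[i]), ccont f -> ccont (fun x => F (f x))) ->
  (forall z, cabs z <= 1 -> F z != 0) ->
  exists2 m : R, 0 < m & forall z, cabs z <= 1 -> m <= cabs (F z).
Proof.
move=> Fc F0.
pose i (p : R * R) : R[i] := (p.1 +i* p.2)%C.
have ic : ccont i by split; [by move=> p; apply: cvg_fst|by move=> p; apply: cvg_snd].
pose D := [set p : R * R | cabs (i p) <= 1].
have cD : compact D.
  apply: (@subclosed_compact _ _ (`[(-1 : R), 1] `*` `[(-1 : R), 1])).
  - by apply: (@closed_comp _ _ (fun p => cabs (i p)) [set x : R | x <= 1]) => [p _|];
      [exact: ccont_cabs|exact: closed_le].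
  - have := @segment_compact R (-1) 1; move=> sc; apply: compact_setX.
    exact: sc.
  exact: sc.
  move=> p /= p1; rewrite !in_itv /= -!ler_norml.
  by rewrite (le_trans (cabs_Re (i p))) // (le_trans (cabs_Im (i p))).
have D0 : D !=set0 by exists (0, 0); rewrite /D /= /i /= cabs0.
have cG : {within D, continuous (fun p => cabs (F (i p)))}.
  by apply: continuous_subspaceT; apply: ccont_cabs; exact: Fc.
have [p Dp pmin] := compact_EVT_min D0 cD cG.
exists (cabs (F (i p))) => [|z z1]; first by move: Dp; rewrite inE cabs_gt0; exact: F0.
have := pmin (complex.Re z, complex.Im z); rewrite /i /=.
by case: z z1 => x y z1; apply; rewrite inE.
Qed.

(** Provides the uniform lower bound on the denominators met when a scalar delay boundary value
    problem is solved. *)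
Lemma char_lower_bound (a b : R[i]) (tau : R) :
  0 < tau ->
  (forall l, 0 <= complex.Re l -> l - a - cexp (- (l * (tau%:C)%C)) * b != 0) ->
  exists2 m : R, 0 < m & forall z, cabs z <= 1 ->
    m <= cabs (1 - z * cexp ((a + b * z) * (tau%:C)%C)).
Proof.
move=> tau0 ab; apply: disc_lower_bound => [T f cf|z z1].
  apply: ccontD; first exact: ccont_cst.
  under [X in ccont X]funext do rewrite -mulrN1.
  apply: ccontM (ccont_cst _ _); apply: ccontM => //; apply: ccont_cexp.
  apply: ccontM (ccont_cst _ _); apply: ccontD; first exact: ccont_cst.
  by apply: ccontM => //; exact: ccont_cst.
(* A zero [z] gives the characteristic root [a + b z]. *)
rewrite subr_eq0; apply/eqP => zE.
have ez : cexp (- ((a + b * z) * (tau%:C)%C)) = z.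
  by rewrite -[LHS]mul1r zE -mulrA cexpK mulr1.
have := ab (a + b * z); rewrite ez => /(_ _)/eqP; apply; last by ring.
have : cabs (cexp (- ((a + b * z) * (tau%:C)%C))) <= 1 by rewrite ez.
by rewrite cabs_cexp -expR0 ler_expR ReN ReM /= mulr0 subr0 oppr_le0 pmulr_lge0.
Qed.

End ComplexValued.

(** * Retarded equations *)

Definition mxsum (R : realType) m n (Q : 'M[R[i]]_(m, n)) : R :=
  \sum_i \sum_j cabs (Q i j).

Lemma mxsum_ge0 (R : realType) m n (Q : 'M[R[i]]_(m, n)) : 0 <= mxsum Q.
Proof. by apply: sumr_ge0 => i _; apply: sumr_ge0 => j _; exact: cabs_ge0. Qed.

Lemma mulmx_bound (R : realType) m n (Q : 'M[R[i]]_(m, n)) (v : 'cV_n) (x : R) :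
  (forall j, cabs (v j 0) <= x) -> forall i, cabs ((Q *m v) i 0) <= mxsum Q * x.
Proof.
(* The sign of [x] is read off an entry of [v]; when [v] has no entry, both sides are zero. *)
move=> vx i; case: n => [|n] in Q v vx *.
  rewrite mxE big_ord0 cabs0 /mxsum big1 ?mul0r // => k _.
  by rewrite big_ord0.
have x0 : 0 <= x by rewrite (le_trans (cabs_ge0 _) (vx ord0)).
rewrite mxE (le_trans (cabs_sum _ _ _)) // /mxsum mulr_suml (bigD1 i) //=.
rewrite -[leLHS]addr0 lerD //.
  rewrite mulr_suml; apply: ler_sum => j _.
  by rewrite cabsM ler_wpM2l ?cabs_ge0.
by apply: sumr_ge0 => k _; rewrite mulr_ge0 // sumr_ge0 // => j _; exact: cabs_ge0.
Qed.

(** Decay by [g] per delay is decay at rate [ln g / tau] per unit of time. *)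
Lemma exp_of_geometric (R : realType) (tau g : R) : 0 < tau -> 1 < g ->
  exists2 gamma : R, 0 < gamma & forall (t : R) n, 0 <= t -> t <= n%:R * tau ->
    g ^- n <= expR (- gamma * t).
Proof.
move=> tau0 g1; have g0 : 0 < g by apply: lt_trans g1.
have l0 : 0 < ln g by rewrite ln_gt0.
exists (ln g / tau) => [|t n t0 tn]; first by rewrite divr_gt0.
have -> : g ^- n = expR (- (n%:R * ln g)).
  by rewrite expRN expRM_natl lnK.
rewrite ler_expR mulNr lerN2 mulrAC ler_pdivrMr // mulrAC.
by rewrite [leRHS]mulrC ler_wpM2l // ltW.
Qed.

Lemma delay_decomposition (R : realType) (tau t : R) : 0 < tau -> 0 <= t ->
  exists n (s : R), [/\ - tau <= s <= 0, t = s + n%:R * tau & t <= n%:R * tau].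
Proof.
move=> tau0 t0; pose n := Num.truncn (t / tau).
have /andP[nt tn] : n%:R <= t / tau < n.+1%:R.
  by rewrite truncn_itv // divr_ge0 // ltW.
(* One more than the quotient, so that the remainder falls in the history interval. *)
exists n.+1, (t - n.+1%:R * tau).
rewrite ler_pdivlMr // in nt; rewrite ltr_pdivrMr // in tn.
have tn' : t <= n.+1%:R * tau by exact: ltW.
split; rewrite ?subrK // subr_le0 tn' andbT lerBrDr -natr1 mulrDl mul1r.
by rewrite addrCA addNr addr0.
Qed.

Section DelayEquation.
Variables (R : realType) (tau : R).
Hypothesis tau0 : 0 < tau.
Variable n : nat.
Implicit Types (A B : 'M[R[i]]_n) (y : R -> 'cV[R[i]]_n) (z : R[i]).

Lemma ccont_within_mulmx m p (Q : 'M[R[i]]_(m, p)) (D : set R)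
  (y : R -> 'cV[R[i]]_p) :
  ccont_within D y -> ccont_within D (fun s => Q *m y s).
Proof.
move=> cy i; have -> : (fun s => complex.Re ((Q *m y s) i 0)) =
    (fun s => complex.Re (\sum_j Q i j * y s j 0)) by apply/funext => s; rewrite mxE.
have -> : (fun s => complex.Im ((Q *m y s) i 0)) =
    (fun s => complex.Im (\sum_j Q i j * y s j 0)) by apply/funext => s; rewrite mxE.
apply: (@ccont_sum _ (subspace D) _ _ _ (fun j s => Q i j * y s j 0)) => j.
by apply: ccontM; [exact: ccont_cst|exact: cy].
Qed.

Lemma has_deriv_mulmx m p (Q : 'M[R[i]]_(m, p)) (y : R -> 'cV[R[i]]_p) t d :
  has_deriv y t d -> has_deriv (fun s => Q *m y s) t (Q *m d).
Proof.
move=> dy i; rewrite mxE.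
have -> : (fun s => complex.Re ((Q *m y s) i 0)) =
    (fun s => complex.Re (\sum_j Q i j * y s j 0)) by apply/funext => s; rewrite mxE.
have -> : (fun s => complex.Im ((Q *m y s) i 0)) =
    (fun s => complex.Im (\sum_j Q i j * y s j 0)) by apply/funext => s; rewrite mxE.
apply: (@cderiv_sum _ _ _ _ (fun j s => Q i j * y s j 0)) => j _.
by apply: cderivZ; exact: dy.
Qed.

Definition nonmultiple (t : R) := forall k : nat, t != k%:R * tau.

Definition hist_cont y := forall j,
  ccont ((fun s => y s j 0) : subspace [set s | - tau <= s] -> R[i]).

Definition dde_sol A B y := hist_cont y /\
  forall t, 0 < t -> nonmultiple t -> forall j,
    cderiv (fun s => y s j 0) t ((A *m y t + B *m y (t - tau)) j 0).

Lemma nonmultiple_lt t k : k%:R * tau < t -> t < k.+1%:R * tau -> nonmultiple t.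
Proof.
move=> kt tk j; apply/eqP => tj; move: kt tk.
by rewrite tj !ltr_pM2r // !ltr_nat; lia.
Qed.

(** Only the history is measured; a bound on [iter k shift y] is therefore a bound on [y] over the
    [k]-th delay interval. *)
Let Bd (y : R -> 'cV[R[i]]_n) (x : R) :=
  forall s, - tau <= s <= 0 -> forall j, cabs (y s j 0) <= x.

Let shift (y : R -> 'cV[R[i]]_n) : R -> 'cV[R[i]]_n := fun s => y (s + tau).

Lemma hist_cont_sub y (D : set R) (h : R) : hist_cont y ->
  (forall s, D s -> - tau <= s + h) ->
  forall j, ccont ((fun s => y (s + h) j 0) : subspace D -> R[i]).
Proof.
move=> cy Dh j; have [c1 c2] := cy j.
have sc s : D s -> (fun r => r + h) @ within D (nbhs s) -->
    within [set s | - tau <= s] (nbhs (s + h)).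
  move=> Ds P sP; change (\forall r \near s, D r -> P (r + h)).
  have sh : (fun r : R => r + h) @ s --> s + h.
    by apply: cvgD; [exact: cvg_id|exact: cvg_cst].
  have h' : nbhs s (fun r => - tau <= r + h -> P (r + h)) by exact: sh sP.
  apply: filterS h' => r rP Dr.
  by apply: rP; exact: Dh.
split; apply/subspace_continuousP => s Ds.
  have /subspace_continuousP h1 := c1.
  exact: (cvg_comp _ _ (sc s Ds) (h1 _ (Dh s Ds))).
have /subspace_continuousP h2 := c2.
exact: (cvg_comp _ _ (sc s Ds) (h2 _ (Dh s Ds))).
Qed.

(** * Retarded systems with triangular coefficients *)

Section Triangular.
Variables A B : 'M[R[i]]_n.
Hypothesis trigA : is_trig_mx A.
Hypothesis trigB : is_trig_mx B.
Hypothesis stable : forall i (l : R[i]), 0 <= complex.Re l ->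
  l - A i i - cexp (- (l * (tau%:C)%C)) * B i i != 0.

(* Writing [psi = shift y] and [g = y - z shift y], the method of steps becomes
   the boundary value problem [psi' = (A + z B) psi + B g],
   [psi (- tau) = g 0 + z psi 0], solved by forward substitution. *)
Let bvp_bound m : exists2 M : R, 0 <= M & forall z y (x : R), cabs z <= 1 ->
  dde_sol A B y -> 0 <= x -> Bd (y - z *: shift y) x ->
  forall (i : 'I_n), (i < m)%N -> forall s, - tau <= s <= 0 ->
  cabs (y (s + tau) i 0) <= M * x.
Proof.
elim: m => [|m [M M0 IH]]; first by exists 0.
have [nm|mn] := leqP n m.
  exists M => // z y x z1 ys x0 gx i _; apply: (IH z y x z1 ys x0 gx i).
  by rewrite (leq_trans (ltn_ord i)).
pose i := Ordinal mn; pose a := A i i; pose b := B i i.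
have [q q0 qF] := char_lower_bound tau0 (@stable i).
pose L := cabs a + cabs b; pose e := expR (L * (0 - - tau)).
(* [kap] bounds the forcing of row [i]: components already estimated by [M], plus the contribution
   of [B g]. [W] is the resulting constant in the variation of constants formula. *)
pose kap := \sum_j (cabs (A i j) + cabs (B i j)) * M + \sum_j cabs (B i j).
pose W := 2 * e ^+ 2 * (0 - - tau) * kap.
have e0 : 0 <= e by exact: expR_ge0.
have kap0 : 0 <= kap.
  by rewrite addr_ge0 // sumr_ge0 // => j _; rewrite ?mulr_ge0 ?addr_ge0 ?cabs_ge0.
have W0 : 0 <= W by rewrite !mulr_ge0 ?exprn_ge0 // sub0r opprK ltW.
have E0 : 0 <= e * ((1 + W) / q) by rewrite mulr_ge0 // divr_ge0 ?addr_ge0 // ltW.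
(* [M] serves the earlier rows, [W] the forced part of row [i], and the last term its initial value
   carried by the exponential. *)
exists (M + (W + e * ((1 + W) / q))) => [|z y x z1 ys x0 gx k km s sb].
  by rewrite addr_ge0 // addr_ge0.
have [km'|km'] := ltnP k m.
  rewrite (le_trans (IH z y x z1 ys x0 gx k km' s sb)) // ler_wpM2r //.
  by rewrite lerDl addr_ge0.
have {km km'} -> : k = i by apply/eqP; rewrite -val_eqE eqn_leq -ltnS km km'.
pose psi s := y (s + tau) i 0; pose c : R[i] := a + b * z.
have cL : cabs c <= L.
  by rewrite (le_trans (cabsD _ _)) // lerD2l cabsM ler_piMr ?cabs_ge0.
(* Writing [y s] as [g s + z y (s + tau)] moves [B i i * z] into the rate [c]; the rest is treated
   as forcing. *)
pose kk s := \sum_(j < n | (j < m)%N) (A i j + B i j * z) * y (s + tau) j 0 +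
  \sum_j B i j * (y s j 0 - z * y (s + tau) j 0).
have voc := @variation_of_constants R psi kk c (- tau) 0 (kap * x) L.
have Wx s' : - tau <= s' <= 0 ->
    cabs (psi s' - cexp (c * ((s' - - tau)%:C)%C) * psi (- tau)) <= W * x.
  move=> s'b; rewrite /W -mulrA; apply: voc => //.
  - by rewrite oppr_le0 ltW.
  - apply: (hist_cont_sub (h := tau)) => [|r /andP[r1 _]]; first exact: ys.1.
    by rewrite (le_trans r1) // lerDl ltW.
  - move=> r /andP[r1 r2].
    have r10 : 0 < r + tau by rewrite -ltrBlDr sub0r.
    have nm : nonmultiple (r + tau).
      by apply: (@nonmultiple_lt _ 0); rewrite ?mul0r // mul1r gtrDr.
    have := cderiv_shift (ys.2 _ r10 nm i); congr cderiv.
    rewrite addrK !mxE /kk /psi /c /a /b.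
    rewrite [\sum_j A i j * _](bigD1 i) //= [\sum_j B i j * (_ - _)](eq_bigr (fun j =>
       B i j * y r j 0 - B i j * z * y (r + tau) j 0)); last by move=> j _; ring.
    rewrite sumrB [X in _ = _ + (_ + (_ - X))](bigD1 i) //=.
    have tri (F : 'I_n -> R[i]) : (forall j : 'I_n, (m < j)%N -> F j = 0) ->
        \sum_(j < n | j != i) F j = \sum_(j < n | (j < m)%N) F j.
      move=> F0; rewrite [RHS]big_mkcond [LHS]big_mkcond /=; apply: eq_bigr => j _.
      case: (ltngtP j m) => [jm|jm|jm].
      - by rewrite ifT // -val_eqE /= ltn_eqF.
      - by rewrite F0 ?if_same.
      - by rewrite ifN // negbK -val_eqE /= jm.
    have tA (j : 'I_n) : (m < j)%N -> A i j = 0 by move/is_trig_mxP: trigA => h mj; exact: h.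
    have tB (j : 'I_n) : (m < j)%N -> B i j = 0 by move/is_trig_mxP: trigB => h mj; exact: h.
    rewrite (tri (fun j => A i j * _)); last by move=> j /tA ->; rewrite mul0r.
    rewrite (tri (fun j => B i j * z * _)); last by move=> j /tB ->; rewrite !mul0r.
    have -> : \sum_(j < n | (j < m)%N) (A i j + B i j * z) * y (r + tau) j 0 =
        \sum_(j < n | (j < m)%N) A i j * y (r + tau) j 0 +
        \sum_(j < n | (j < m)%N) B i j * z * y (r + tau) j 0.
      by rewrite -big_split; apply: eq_bigr => j _; rewrite mulrDl.
    by ring.
  - move=> r /andP[/ltW r1 /ltW r2]; have rb : - tau <= r <= 0 by rewrite r1.
    rewrite /kk (le_trans (cabsD _ _)) // /kap mulrDl lerD //.
      rewrite (le_trans (cabs_sum _ _ _)) // mulr_suml [leLHS]big_mkcond /=.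
      apply: ler_sum => j _; case: ifP => jm; last first.
        by rewrite !mulr_ge0 ?addr_ge0 ?cabs_ge0.
      rewrite cabsM -mulrA; apply: ler_pM; rewrite ?cabs_ge0 //.
        rewrite (le_trans (cabsD _ _)) // lerD2l cabsM ler_piMr ?cabs_ge0 //.
      exact: IH z1 ys x0 gx j jm r rb.
    rewrite (le_trans (cabs_sum _ _ _)) // mulr_suml; apply: ler_sum => j _.
    by rewrite cabsM ler_wpM2l ?cabs_ge0 //; have := gx r rb j; rewrite !mxE.
  - by rewrite mulr_ge0.
have tau00 : - tau <= (0 : R) <= 0 by rewrite lexx oppr_le0 ltW.
(* The boundary condition turns into a scalar equation for [psi (- tau)], with the characteristic
   denominator bounded below by [q]. *)
have pb : cabs (psi (- tau)) <= (1 + W) / q * x.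
  have pE : psi (- tau) * (1 - z * cexp (c * (tau%:C)%C)) =
      (y 0 - z *: y (0 + tau)) i 0 + z * (psi 0 - cexp (c * ((0 - - tau)%:C)%C) * psi (- tau)).
    by rewrite /psi !mxE addNr sub0r opprK; ring.
  rewrite mulrAC ler_pdivlMr // (@le_trans _ _
    (cabs (psi (- tau) * (1 - z * cexp (c * (tau%:C)%C))))) //.
    by rewrite cabsM ler_wpM2l ?cabs_ge0 // qF.
  rewrite pE (le_trans (cabsD _ _)) // [leRHS]mulrDl mul1r lerD //; first exact: gx.
  by rewrite cabsM (le_trans (ler_piMl (cabs_ge0 _) z1)) // Wx.
have -> : y (s + tau) i 0 = (psi s - cexp (c * ((s - - tau)%:C)%C) * psi (- tau)) +
    cexp (c * ((s - - tau)%:C)%C) * psi (- tau) by rewrite subrK.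
rewrite (le_trans (cabsD _ _)) //.
apply: (@le_trans _ _ ((W + e * ((1 + W) / q)) * x)); last first.
  by rewrite ler_wpM2r // lerDr.
rewrite [leRHS]mulrDl lerD ?Wx // cabsM -mulrA ler_pM ?cabs_ge0 //.
have /andP[s1 s2] := sb; rewrite cabs_cexp ler_expR Re_mul_real_le //.
by rewrite subr_ge0 s1 lerD2r.
Qed.

(** [power_decay] for the shift on solutions. Since [u = g + z shift u], the resolvent constant is
    [1 + M]; the case [z = 0] of the same boundary value bound shows that the shift is bounded. *)
Lemma dde_geometric : exists C g : R, [/\ 0 < C, 1 < g &
  forall y (x : R), dde_sol A B y -> 0 <= x ->
  (forall s, - tau <= s <= 0 -> forall j, cabs (y s j 0) <= x) ->
  forall k s, - tau <= s <= 0 -> forall j,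
    cabs (y (s + k%:R * tau) j 0) <= C * g ^- k * x].
Proof.
have [M M0 HM] := bvp_bound n.
have HM' z y x : cabs z <= 1 -> dde_sol A B y -> 0 <= x -> Bd (y - z *: shift y) x ->
    Bd (shift y) (M * x).
  by move=> z1 ys x0 gx s sb j; exact: HM z1 ys x0 gx j (ltn_ord j) s sb.
have M1 : 1 <= 1 + M by rewrite lerDl.
have [||||||||||||C [g [C0 g1 Hd]]] := @power_decay R
  (R -> 'cV[R[i]]_n) (dde_sol A B) shift Bd _ _ _ _ _ _ _ _ _ _ (1 + M) (1 + M) M1 M1.
- by move=> c u v.
- split=> [j|t t0 nm j].
    have -> : (fun s => (0 : R -> 'cV[R[i]]_n) s j 0) = fun=> 0.
      by apply/funext => s; rewrite mxE.
    exact: ccont_cst.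
  have -> : (fun s => (0 : R -> 'cV[R[i]]_n) s j 0) = fun=> 0.
    by apply/funext => s; rewrite mxE.
  by rewrite !mulmx0 addr0 mxE; exact: cderiv_cst.
- move=> u v [cu du] [cv dv]; split=> [j|t t0 nm j].
    have -> : (fun s => (u + v) s j 0) = fun s => u s j 0 + v s j 0.
      by apply/funext => s; rewrite mxE.
    exact: ccontD.
  have -> : (fun s => (u + v) s j 0) = fun s => u s j 0 + v s j 0.
    by apply/funext => s; rewrite mxE.
  have := cderivD (du t t0 nm j) (dv t t0 nm j); congr cderiv.
  rewrite -[(u + v) t]/(u t + v t) -[(u + v) (_ - _)]/(u (_ - _) + v (_ - _)).
  by rewrite !mulmxDr addrACA [RHS]mxE.
- move=> c u [cu du]; split=> [j|t t0 nm j].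
    have -> : (fun s => (c *: u) s j 0) = fun s => c * u s j 0.
      by apply/funext => s; rewrite mxE.
    by apply: ccontM => //; exact: ccont_cst.
  have -> : (fun s => (c *: u) s j 0) = fun s => c * u s j 0.
    by apply/funext => s; rewrite mxE.
  have := cderivZ c (du t t0 nm j); congr cderiv.
  rewrite -[(c *: u) t]/(c *: u t) -[(c *: u) (t - tau)]/(c *: u (t - tau)).
  by rewrite -!scalemxAr -scalerDr [RHS]mxE.
- move=> u [cu du]; split=> [j|t t0 nm j].
    apply: (hist_cont_sub (h := tau)) => // s /= st.
    by rewrite (le_trans st) // lerDl ltW.
  rewrite /shift; apply: (@cderiv_shift _ (fun s => u s j 0)).
  rewrite subrK; have := du (t + tau); rewrite addrK; apply; first by rewrite addr_gt0.
  move=> [|k]; first by rewrite mul0r gt_eqF // addr_gt0.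
  by apply: contra (nm k) => /eqP/(canRL (addrK _)) ->; rewrite -natr1 mulrDl mul1r addrK.
- by move=> s sb j; rewrite mxE cabs0.
- by move=> u v x y ux vy s sb j; rewrite mxE (le_trans (cabsD _ _)) // lerD ?ux ?vy.
- by move=> c u x ux s sb j; rewrite mxE cabsM ler_wpM2l ?cabs_ge0 ?ux.
- by move=> u x y xy ux s sb j; rewrite (le_trans (ux s sb j)).
- by move=> u x ux s sb j; apply/ler_addgt0Pr => e e0; exact: ux.
- move=> u x Su x0 ux s sb j; have := @HM' 0 u x; rewrite scale0r subr0 cabs0 => h.
  by rewrite (le_trans (h ler01 Su x0 ux s sb j)) // ler_wpM2r // lerDr.
- move=> z u x z1 Su x0 ux s sb j.
  have -> : u s j 0 = (u - z *: shift u) s j 0 + z * shift u s j 0.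
    by rewrite !mxE subrK.
  rewrite (le_trans (cabsD _ _)) // mulrDl mul1r lerD ?ux //.
  by rewrite cabsM (le_trans (ler_piMl (cabs_ge0 _) z1)) // (HM' _ _ _ z1 Su x0 ux).
exists C, g; split=> // y x ys x0 yx k s sb j.
suff -> : y (s + k%:R * tau) = iter k shift y s by exact: Hd.
elim: k s {sb} => [|k IH] s /=; first by rewrite mul0r addr0.
by rewrite /shift -IH -natr1 mulrDl mul1r addrA addrAC.
Qed.

End Triangular.

(** Commuting matrices are triangularised simultaneously. The characteristic determinant is then a
    product of scalar characteristic functions, none of which can vanish in the closed right half
    plane. *)
Lemma dde_exp_decay A B : A *m B = B *m A ->
  (forall l : R[i], 0 <= complex.Re l ->
     \det (l%:M - A - cexp (- (l * (tau%:C)%C)) *: B) != 0) ->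
  exists delta gamma : R, [/\ 0 < delta, 0 < gamma &
  forall y (x : R), dde_sol A B y -> 0 <= x ->
  (forall s, - tau <= s <= 0 -> forall j, cabs (y s j 0) <= x) ->
  forall t, 0 <= t -> forall j, cabs (y t j 0) <= delta * expR (- gamma * t) * x].
Proof.
move=> AB dAB; have [P Pu /andP[tA tB]] := cotrigonalization2 AB.
have Pun := unitarymx_unit Pu.
rewrite /similar_to !(conjumx _ Pun) in tA tB.
have st i (l : R[i]) : 0 <= complex.Re l -> l - (P *m A *m invmx P) i i -
    cexp (- (l * (tau%:C)%C)) * (P *m B *m invmx P) i i != 0.
  move=> l0; apply: contra (dAB l l0) => /eqP h; set X := (X in \det X).
  have XE : P *m X *m invmx P = l%:M - P *m A *m invmx P -
      cexp (- (l * (tau%:C)%C)) *: (P *m B *m invmx P).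
    by rewrite /X !mulmxBr !mulmxBl -scalemxAr -scalemxAl scalar_mxC mulmxK.
  have ent (A' B' : 'M[R[i]]_n) c j k :
      (l%:M - A' - c *: B') j k = l *+ (j == k) - A' j k - c * B' j k by rewrite !mxE.
  have : \det (P *m X *m invmx P) == 0.
    rewrite XE det_trig; last first.
      apply/is_trig_mxP => j k jk; move/is_trig_mxP: tA => tA; move/is_trig_mxP: tB => tB.
      by rewrite ent tA // tB // -val_eqE /= ltn_eqF // mulr0n mulr0 !subr0.
    rewrite prodf_seq_eq0; apply/hasP; exists i; first by rewrite mem_index_enum.
    by rewrite /= ent eqxx mulr1n h.
  by rewrite !det_mulmx mulrAC -det_mulmx mulmxV // det1 mul1r.
have [C [g [C0 g1 H]]] := dde_geometric tA tB st.
have [gam gam0 Hg] := exp_of_geometric tau0 g1.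
(* The summand 1 keeps the constant positive in dimension zero. *)
exists (mxsum (invmx P) * (C * mxsum P) + 1), gam; split => //.
  by rewrite ltr_wpDl // !mulr_ge0 ?mxsum_ge0 // ltW.
move=> y x [cy dy] x0 yx t t0 j.
have ws : dde_sol (P *m A *m invmx P) (P *m B *m invmx P) (fun s => P *m y s).
  split; first exact: (ccont_within_mulmx P cy).
  move=> r r0 nr; have := has_deriv_mulmx P (dy r r0 nr).
  by rewrite mulmxDr !mulmxA !mulmxKV.
have x'0 : 0 <= mxsum P * x by rewrite mulr_ge0 // mxsum_ge0.
have [k [s [sb tE tk]]] := delay_decomposition tau0 t0.
have := H _ _ ws x'0 (fun s sb => mulmx_bound P (yx s sb)) k s sb.
rewrite -tE => /(@mulmx_bound _ _ _ (invmx P) _ _)/(_ j).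
rewrite mulmxA mulVmx // mul1mx => /le_trans; apply.
have E0 := expR_ge0 (- gam * t).
apply: (@le_trans _ _ (mxsum (invmx P) * (C * expR (- gam * t) * (mxsum P * x)))).
  rewrite ler_wpM2l ?mxsum_ge0 // ler_wpM2r // ler_wpM2l ?(ltW C0) //.
  exact: Hg.
have -> : mxsum (invmx P) * (C * expR (- gam * t) * (mxsum P * x)) =
  mxsum (invmx P) * (C * mxsum P) * expR (- gam * t) * x by ring.
by rewrite ler_wpM2r // ler_wpM2r // lerDl.
Qed.

End DelayEquation.

(** * Algebraic and advanced equations *)

Lemma invmx_comm (F : fieldType) n (A X : 'M[F]_n) : A \in unitmx ->
  X *m A = A *m X -> invmx A *m X = X *m invmx A.
Proof.
by move=> uA XA; rewrite -[LHS](mulmxK uA) -(mulmxA _ X) XA mulmxA mulVmx // mul1mx.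
Qed.

(** The last nonzero vector among [v], [v N], [v N^2], and so on is killed by [N], and commutation
    keeps it an eigenvector of [X]. *)
Lemma nilpotent_common_eigenvector (F : fieldType) n (X N : 'M[F]_n) (a : F)
  (v : 'rV_n) k : X *m N = N *m X -> N ^+ k = 0 -> v != 0 -> v *m X = a *: v ->
  exists w : 'rV_n, [/\ w != 0, w *m X = a *: w & w *m N = 0].
Proof.
move=> XN Nk v0 vX; have vNk : v *m N ^+ k = 0 by rewrite Nk mulmx0.
elim: k v v0 vX vNk {Nk} => [|k IH] v v0 vX.
  by rewrite expr0 mulmx1 => v00; rewrite v00 eqxx in v0.
have [vN0|vN0] := eqVneq (v *m N) 0; first by exists v.
rewrite exprS -mulmxE mulmxA; apply: IH => //.
by rewrite -mulmxA -XN mulmxA vX scalemxAl.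
Qed.

Lemma nilpotent_pencil_singular (F : fieldType) n (X Y : 'M[F]_n) (a : F) k l :
  (0 < n)%N -> X *m Y = Y *m X -> X ^+ k = 0 -> Y ^+ l = 0 -> \det (- X - a *: Y) = 0.
Proof.
move=> n0 XY Xk Yl.
have v0 : (const_mx 1 : 'rV[F]_n) != 0.
  by apply/eqP => /rowP/(_ (Ordinal n0))/eqP; rewrite !mxE oner_eq0.
(* Every vector is an eigenvector of the identity, so this first use yields a kernel vector of [X];
   the second use makes it common with [Y]. *)
have [v [v1 _ vX]] : exists w : 'rV_n, [/\ w != 0, w *m 1%:M = 1 *: w & w *m X = 0].
  apply: (nilpotent_common_eigenvector (k := k) _ Xk v0); first by rewrite mulmx1 mul1mx.
  by rewrite mulmx1 scale1r.
have [w [w0 wX wY]] : exists w : 'rV_n, [/\ w != 0, w *m X = 0 *: w & w *m Y = 0].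
  by apply: (nilpotent_common_eigenvector XY Yl v1); rewrite vX scale0r.
apply/eqP/det0P; exists w => //.
by rewrite mulmxBr mulmxN wX -scalemxAr wY scale0r scaler0 subr0 oppr0.
Qed.

Section Algebraic.
Variables (R : realType) (tau : R).
Hypothesis tau0 : 0 < tau.
Variable n : nat.
Implicit Types (y : R -> 'cV[R[i]]_n) (z : R[i]).

(** Carries estimates to the multiples of [tau], where the differential equation gives no
    information. *)
Lemma cabs_le_right_limit y (b t e : R) (j : 'I_n) :
  hist_cont tau y -> - tau <= t -> 0 < e ->
  (forall r, t < r < t + e -> cabs (y r j 0) <= b) -> cabs (y t j 0) <= b.
Proof.
move=> cy tt e0 yb; have cj := ccont_cabs (cy j).
have /subspace_continuousP h := cj.
have {}h : (fun r => cabs (y r j 0)) @ t^'+ --> cabs (y t j 0).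
  apply: cvg_trans (h t tt); apply: cvg_app => P.
  move=> sP; change (\forall r \near t, t < r -> P r).
  have {}sP : \forall r \near t, - tau <= r -> P r by exact: sP.
  apply: filterS sP => r rP tr.
  by apply: rP; rewrite /= (le_trans tt) // ltW.
apply: (closed_cvg (fun x => x <= b)) h; first exact: closed_le.
have te : t < t + e by rewrite ltrDl.
near=> r; apply: yb; apply/andP; split.
  by near: r; exact: nbhs_right_gt.
by near: r; exact: nbhs_right_lt.
Unshelve. all: by end_near.
Qed.

Lemma nonmultiple_decomposition (t : R) : 0 <= t -> nonmultiple tau t ->
  exists k (s : R), [/\ - tau < s < 0, t = s + k%:R * tau & t <= k%:R * tau].
Proof.
move=> t0 nm; have [k [s [/andP[s1 s2] tE tk]]] := delay_decomposition tau0 t0.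
exists k, s; split => //; rewrite !lt_neqAle s1 s2 !andbT; apply/andP; split.
  apply/eqP => sE; case: k => [|k] in tE tk *.
    by move: t0; rewrite tE -sE mul0r addr0 oppr_ge0 leNgt tau0.
  by have := nm k; rewrite tE -sE -natr1 mulrDl mul1r addrCA addNr addr0 eqxx.
by apply/eqP => sE; have := nm k; rewrite tE sE add0r eqxx.
Qed.

Lemma nonmultiple_interval (s : R) k : - tau < s < 0 ->
  0 < s + k.+1%:R * tau /\ nonmultiple tau (s + k.+1%:R * tau).
Proof.
move=> /andP[s1 s2].
have k1 : k%:R * tau < s + k.+1%:R * tau.
  by rewrite -natr1 mulrDl mul1r addrCA ltrDl -ltrBlDr sub0r.
split; first by rewrite (le_lt_trans _ k1) // mulr_ge0 // ltW.
by apply: nonmultiple_lt k1 _ => //; rewrite gtrDr.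
Qed.

(** * Advanced equations *)

Section Advanced.
Variables E A J : 'M[R[i]]_n.
Hypotheses (EA : E *m A = A *m E) (EJ : E *m J = J *m E) (AJ : A *m J = J *m A).

(** After multiplication by [E ^+ a *m A ^+ b], the equation at [t] retains only its delayed term,
    provided the products with one more factor [E] or [A] kill the solution. As [J] is invertible,
    this settles the value at [t - tau], so the history vanishes as well. *)
Lemma advanced_solution_eq0 k l y : J \in unitmx -> E ^+ k = 0 -> A ^+ l = 0 ->
  hist_cont tau y ->
  (forall t, 0 < t -> nonmultiple tau t ->
    has_deriv (fun s => E *m y s) t (A *m y t + J *m y (t - tau))) ->
  forall t, - tau <= t -> y t = 0.
Proof.
move=> uJ Ek Al cy dy.
(* [m] measures how far [a + b] is from [k + l], where one of the two powers must vanish. *)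
suff H m a b : (k + l <= a + b + m)%N ->
    forall t, - tau <= t -> E ^+ a *m A ^+ b *m y t = 0.
  move=> t tt; have := H (k + l)%N 0%N 0%N; rewrite !expr0 mulmx1 => h.
  by rewrite -[y t]mul1mx h.
elim: m a b => [|m IH] a b.
  rewrite addn0 => kl t _; have [ka|ak] := leqP k a.
    by rewrite -(subnKC ka) exprD Ek mul0r mul0mx mul0mx.
  have lb : (l <= b)%N by lia.
  by rewrite -(subnKC lb) exprD Al mul0r mulmx0 mul0mx.
move=> klm; pose Q := E ^+ a *m A ^+ b.
have QA : Q *m A = E ^+ a *m A ^+ b.+1 by rewrite /Q -mulmxA mulmxE -exprSr.
have AbE : A ^+ b *m E = E *m A ^+ b.
  by apply/esym; apply: (@commrX _ E A); rewrite /GRing.comm -mulmxE.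
have QE : Q *m E = E ^+ a.+1 *m A ^+ b by rewrite /Q -mulmxA AbE mulmxA mulmxE -exprSr.
have QJ : Q *m J = J *m Q.
  have cE : GRing.comm J E by rewrite /GRing.comm -mulmxE.
  have cA : GRing.comm J A by rewrite /GRing.comm -mulmxE.
  have := commrM (commrX a cE) (commrX b cA).
  by rewrite /GRing.comm -mulmxE => <-.
have H1 t : - tau <= t -> Q *m E *m y t = 0.
  by move=> tt; rewrite QE IH //; lia.
have H2 t : - tau <= t -> Q *m A *m y t = 0.
  by move=> tt; rewrite QA IH //; lia.
have H3 s : - tau < s -> nonmultiple tau (s + tau) -> Q *m y s = 0.
  move=> ss nm; have st0 : 0 < s + tau by rewrite -ltrBlDr sub0r.
  have d1 := has_deriv_mulmx Q (dy _ st0 nm).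
  rewrite addrK mulmxDr !mulmxA H2 ?add0r ?QJ in d1; last first.
    by rewrite (le_trans _ (ltW st0)) // oppr_le0 ltW.
  have JQ : J *m Q *m y s = 0.
    apply/colP => i; apply: (cderiv_unique (d1 i)); rewrite mxE.
    apply: (@cderiv_eq_itv _ (fun=> 0) _ 0 (s + tau + 1)); last exact: cderiv_cst.
      by rewrite st0 ltrDl ltr01.
    by move=> r /andP[r0 _]; rewrite mulmxA H1 ?mxE // (le_trans _ (ltW r0)) // oppr_le0 ltW.
  by rewrite -[Q *m y s]mul1mx -(mulVmx uJ) -mulmxA [J *m (Q *m _)]mulmxA JQ mulmx0.
(* The exceptional times are right limits: [r + tau] avoids the multiples of [tau] for [r] slightly
   larger than [t]. *)
have cQ := ccont_within_mulmx Q cy.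
move=> t tt; apply/colP => i; rewrite [RHS]mxE; apply: cabs_eq0; apply/eqP.
rewrite eq_le cabs_ge0 andbT.
have tp : 0 <= t + tau by rewrite -lerBlDr sub0r.
pose m' := Num.truncn ((t + tau) / tau).
have /andP[t1 t2] : m'%:R <= (t + tau) / tau < m'.+1%:R.
  by rewrite truncn_itv // divr_ge0 // ltW.
rewrite ler_pdivlMr // in t1; rewrite ltr_pdivrMr // in t2.
have e0 : 0 < m'.+1%:R * tau - (t + tau) by rewrite subr_gt0.
apply: (cabs_le_right_limit (e := m'.+1%:R * tau - (t + tau)) cQ tt) => // r /andP[r1 r2].
rewrite H3 ?mxE ?cabs0 //; first exact: le_lt_trans r1.
apply: (@nonmultiple_lt _ _ tau0 _ m'); first by rewrite (le_lt_trans t1) // ltrD2r.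
by move: r2; rewrite opprD addrCA [t + _]addrA subrr add0r ltrBrDr.
Qed.

End Advanced.

(** * Algebraic equations: propagation of jets over one delay *)

Section Jet.
Variable p : nat.

(** The equation [y = (M y)' + L y(. - tau)] is solved by the finite Neumann series of [M D] with
    [D] the derivative. In terms of [u j = M^j D^j y] on the previous interval, the new [j]-th entry
    is [L] times the tail sum from [j]. *)
Definition jet_step (L : 'M[R[i]]_n) (u : nat -> 'cV[R[i]]_n) : nat -> 'cV[R[i]]_n :=
  fun j => L *m \sum_(j <= m < p.+1) u m.

Let Bd (u : nat -> 'cV[R[i]]_n) (x : R) :=
  forall j, (j <= p)%N -> forall i, cabs (u j i 0) <= x.

(** The jet step is itself triangular with the [L i i] on its diagonal, so [1 - z L i i] is at least
    [1 - cabs (L i i)] in modulus over the closed disc, and [power_decay] applies. *)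
Lemma jet_step_trig_decay (L : 'M[R[i]]_n) :
  is_trig_mx L -> (forall i, cabs (L i i) < 1) ->
  exists C g : R, [/\ 0 < C, 1 < g & forall u (x : R), 0 <= x -> Bd u x ->
    forall k, Bd (iter k (jet_step L) u) (C * g ^- k * x)].
Proof.
move=> /is_trig_mxP tL L1.
have lin c u v : jet_step L (c *: u + v) = c *: jet_step L u + jet_step L v.
  apply/funext => j; rewrite /jet_step.
  rewrite (eq_bigr (fun m => c *: u m + v m)) // big_split /= -scaler_sumr.
  by rewrite mulmxDr -scalemxAr.
have sumB u x j i : Bd u x -> 0 <= x ->
    cabs ((\sum_(j <= m < p.+1) u m) i 0) <= p.+1%:R * x.
  move=> ux x0; rewrite summxE (le_trans (cabs_sum _ _ _)) //.
  apply: (@le_trans _ _ (\sum_(j <= m < p.+1) x)).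
    rewrite big_nat_cond [leRHS]big_nat_cond; apply: ler_sum => m.
    by rewrite andbT => /andP[_ mp]; exact: ux.
  by rewrite sumr_const_nat -[leLHS]mulr_natl ler_wpM2r // ler_nat leq_subr.
(* Triangular solve in the order of increasing rank [i * (p + 1) + (p - j)]. *)
have res r : exists2 M : R, 0 <= M & forall z u (x : R), cabs z <= 1 -> 0 <= x ->
    Bd (u - z *: jet_step L u) x ->
    forall (i : 'I_n) j, (j <= p)%N -> (i * p.+1 + (p - j) < r)%N ->
    cabs (u j i 0) <= M * x.
  elim: r => [|r [M M0 IH]]; first by exists 0.
  pose kap := \sum_(i < n) \sum_(l < n) cabs (L i l) * (p.+1%:R * M).
  have kap0 : 0 <= kap.
    by apply: sumr_ge0 => i _; apply: sumr_ge0 => l _; rewrite !mulr_ge0 ?cabs_ge0.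
  (* A sum replaces the maximum of the reciprocal denominators. *)
  pose Q := \sum_(i < n) (1 - cabs (L i i))^-1.
  have Qi i : (1 - cabs (L i i))^-1 <= Q.
    rewrite /Q (bigD1 i) //= lerDl sumr_ge0 // => l _.
    by rewrite invr_ge0 subr_ge0 ltW.
  have Q0 : 0 <= Q by apply: sumr_ge0 => l _; rewrite invr_ge0 subr_ge0 ltW.
  exists (M + (1 + kap) * Q) => [|z u x z1 x0 gx i j jp].
    by rewrite addr_ge0 // mulr_ge0 // addr_ge0.
  have Mx0 : 0 <= M * x by rewrite mulr_ge0.
  have ex0 : 0 <= (1 + kap) * Q * x by rewrite !mulr_ge0 // addr_ge0.
  rewrite ltnS leq_eqVlt => /orP[/eqP rE|rl]; last first.
    rewrite (le_trans (IH z u x z1 x0 gx i j jp rl)) // ler_wpM2r //.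
    by rewrite lerDl mulr_ge0 // addr_ge0.
  have small (l : 'I_n) m : (l <= i)%N -> (j <= m <= p)%N -> ((l < i) || (j < m))%N ->
      cabs (u m l 0) <= M * x.
    move=> li /andP[jm mp] lt; apply: (IH z u x z1 x0 gx l m mp); rewrite -rE.
    case/orP: lt => [lt|lt]; last first.
      have : (l * p.+1 <= i * p.+1)%N by rewrite leq_mul2r li orbT.
      by lia.
    have : (l.+1 * p.+1 <= i * p.+1)%N by rewrite leq_mul2r lt orbT.
    by rewrite mulSn; lia.
  (* In row [i] the tail starts at [j.+1]: the omitted term holds the unknown [u j i], which moves
     to the left-hand side in [key]. *)
  pose rest (l : 'I_n) := if l == i then \sum_(j.+1 <= m < p.+1) u m else
    \sum_(j <= m < p.+1) u m.
  have restB (l : 'I_n) : (l <= i)%N -> cabs (rest l l 0) <= p.+1%:R * (M * x).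
    move=> li; rewrite /rest; case: eqP => [->|/eqP lni].
      rewrite summxE (le_trans (cabs_sum _ _ _)) //.
      apply: (@le_trans _ _ (\sum_(j.+1 <= m < p.+1) M * x)).
        rewrite big_nat_cond [leRHS]big_nat_cond; apply: ler_sum => m.
        by rewrite andbT => /andP[jm mp]; apply: small; rewrite ?jm ?orbT // (ltnW jm).
      by rewrite sumr_const_nat -[leLHS]mulr_natl ler_wpM2r // ler_nat; lia.
    rewrite summxE (le_trans (cabs_sum _ _ _)) //.
    apply: (@le_trans _ _ (\sum_(j <= m < p.+1) M * x)).
      rewrite big_nat_cond [leRHS]big_nat_cond; apply: ler_sum => m.
      rewrite andbT => /andP[jm mp]; apply: small; rewrite ?jm // ltn_neqAle li.
      by rewrite (inj_eq val_inj) lni.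
    by rewrite sumr_const_nat -[leLHS]mulr_natl ler_wpM2r // ler_nat leq_subr.
  have key : u j i 0 * (1 - z * L i i) =
      (u - z *: jet_step L u) j i 0 + z * \sum_l L i l * rest l l 0.
    have -> : (u - z *: jet_step L u) j i 0 =
        u j i 0 - z * \sum_l L i l * (\sum_(j <= m < p.+1) u m) l 0.
      by rewrite !mxE.
    rewrite (bigD1 i) //= [\sum_l L i l * rest l l 0](bigD1 i) //=.
    rewrite [X in _ = _ - z * (_ + X) + _](eq_bigr (fun l => L i l * rest l l 0)); last first.
      by move=> l lni; rewrite /rest (negPf lni).
    rewrite /rest eqxx big_ltn ?ltnS // mxE; ring.
  have den : 0 < 1 - cabs (L i i) by rewrite subr_gt0.
  have den1 : 1 - cabs (L i i) <= cabs (1 - z * L i i).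
    rewrite lerBlDr -[leLHS](cabs1 R) -{1}(subrK (z * L i i) 1) (le_trans (cabsD _ _)) //.
    by rewrite lerD2l cabsM ler_piMl ?cabs_ge0.
  apply: (@le_trans _ _ ((1 + kap) * x * (1 - cabs (L i i))^-1)); last first.
    rewrite [leRHS]mulrDl -[leLHS]add0r lerD // [leRHS]mulrAC ler_wpM2l //.
    by rewrite mulr_ge0 // addr_ge0.
  rewrite ler_pdivlMr //; apply: (@le_trans _ _ (cabs (u j i 0 * (1 - z * L i i)))).
    by rewrite cabsM ler_wpM2l ?cabs_ge0.
  rewrite key (le_trans (cabsD _ _)) // mulrDl mul1r lerD //; first exact: gx.
  rewrite cabsM (le_trans (ler_piMl (cabs_ge0 _) z1)) // (le_trans (cabs_sum _ _ _)) //.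
  apply: (@le_trans _ _ ((\sum_l cabs (L i l) * (p.+1%:R * M)) * x)); last first.
    rewrite ler_wpM2r // /kap [leRHS](bigD1 i) //= lerDl sumr_ge0 // => k _.
    by rewrite sumr_ge0 // => l _; rewrite !mulr_ge0 ?cabs_ge0.
  rewrite mulr_suml; apply: ler_sum => l _; rewrite cabsM -!mulrA.
  have [li|il] := leqP l i; first by rewrite ler_wpM2l ?cabs_ge0 // restB.
  by rewrite tL // cabs0 !mul0r.
have [M M0 HM] := res (n * p.+1)%N.
have c1 : 1 <= 1 + mxsum L * p.+1%:R by rewrite lerDl mulr_ge0 ?mxsum_ge0.
have M1 : 1 <= 1 + M by rewrite lerDl.
have [|||||||||||C [g [C0 g1 Hd]]] := @power_decay R (nat -> 'cV[R[i]]_n)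
  (fun=> True) (jet_step L) Bd lin _ _ _ _ _ _ _ _ _ _ _ c1 M1 => //.
- by move=> j _ i; rewrite mxE cabs0.
- by move=> u v x y ux vy j jp i; rewrite mxE (le_trans (cabsD _ _)) // lerD ?ux ?vy.
- by move=> c u x ux j jp i; rewrite mxE cabsM ler_wpM2l ?cabs_ge0 ?ux.
- by move=> u x y xy ux j jp i; rewrite (le_trans (ux j jp i)).
- by move=> u x ux j jp i; apply/ler_addgt0Pr => e e0; exact: ux.
- move=> u x _ x0 ux j jp i; rewrite /jet_step.
  rewrite (le_trans (mulmx_bound L (fun l => sumB u x j l ux x0) i)) //.
  by rewrite mulrA ler_wpM2r // lerDr.
- move=> z u x z1 _ x0 ux j jp i.
  rewrite (le_trans (HM z u x z1 x0 ux i j jp _)) ?ler_wpM2r ?lerDr //.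
  have : (i.+1 * p.+1 <= n * p.+1)%N by rewrite leq_mul2r ltn_ord orbT.
  by rewrite mulSn; lia.
by exists C, g; split => // u x x0 ux k; apply: Hd.
Qed.

(** The diagonal of a triangular form of [L] consists of eigenvalues, and multiplying every entry of
    a jet by [P] intertwines the two jet steps. *)
Lemma jet_step_decay (L : 'M[R[i]]_n) :
  (forall a (v : 'rV_n), v != 0 -> v *m L = a *: v -> cabs a < 1) ->
  exists C g : R, [/\ 0 < C, 1 < g & forall u (x : R), 0 <= x -> Bd u x ->
    forall k, Bd (iter k (jet_step L) u) (C * g ^- k * x)].
Proof.
move=> spec; have [P Pu /andP[tL _]] := cotrigonalization2 (erefl (L *m L)).
have Pun := unitarymx_unit Pu.
rewrite /similar_to (conjumx _ Pun) in tL.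
have dL i : cabs ((P *m L *m invmx P) i i) < 1.
  set a := (X in cabs X); have : \det (L - a%:M) == 0.
    have : \det (P *m (L - a%:M) *m invmx P) == 0.
      rewrite mulmxBr mulmxBl scalar_mxC mulmxK //.
      have ent (X : 'M[R[i]]_n) j k : (X - a%:M) j k = X j k - a *+ (j == k) by rewrite !mxE.
      rewrite det_trig; last first.
        apply/is_trig_mxP => j k jk; move/is_trig_mxP: tL => tL.
        by rewrite ent tL // -val_eqE /= ltn_eqF // mulr0n subr0.
      rewrite prodf_seq_eq0; apply/hasP; exists i; first by rewrite mem_index_enum.
      by rewrite /= ent eqxx mulr1n subrr.
    by rewrite !det_mulmx mulrAC -det_mulmx mulmxV // det1 mul1r.
  move=> /det0P[v v0 vL]; apply: (spec a v v0); apply/eqP.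
  by rewrite -subr_eq0 -mul_mx_scalar -mulmxBr vL.
have [C [g [C0 g1 H]]] := jet_step_trig_decay tL dL.
exists (mxsum (invmx P) * (C * mxsum P) + 1), g; split => //.
  by rewrite ltr_wpDl // !mulr_ge0 ?mxsum_ge0 // ltW.
move=> u x x0 ux k j jp i.
have E : iter k (jet_step (P *m L *m invmx P)) (fun j => P *m u j) =
    fun j => P *m iter k (jet_step L) u j.
  elim: k => //= k ->; apply/funext => l; rewrite /jet_step -mulmx_sumr.
  by rewrite !mulmxA mulmxKV.
have x'0 : 0 <= mxsum P * x by rewrite mulr_ge0 // mxsum_ge0.
have := H (fun j => P *m u j) _ x'0 (fun j jp => mulmx_bound P (ux j jp)) k j jp.
rewrite E => /(@mulmx_bound _ _ _ (invmx P) _ _)/(_ i).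
rewrite mulmxA mulVmx // mul1mx => /le_trans; apply.
have g0 : 0 <= g ^- k by rewrite invr_ge0 exprn_ge0 // ltW // (lt_trans _ g1).
have -> : mxsum (invmx P) * (C * g ^- k * (mxsum P * x)) =
  mxsum (invmx P) * (C * mxsum P) * g ^- k * x by ring.
by rewrite ler_wpM2r // ler_wpM2r // lerDl.
Qed.

Variables M L : 'M[R[i]]_n.
Hypothesis ML : M *m L = L *m M.
Hypothesis Mp : M ^+ p.+1 = 0.

(* The entries [u j] play the role of [M ^ j D ^ j y] on one delay interval. *)
Definition jet_family (u : nat -> R -> 'cV[R[i]]_n) :=
  (forall j, (j <= p)%N -> forall s, - tau < s < 0 ->
     has_deriv (fun r => M *m u j r) s (u j.+1 s)) /\
  (forall s, u p.+1 s = 0).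

Lemma has_deriv_sum m1 m2 (u d : nat -> R -> 'cV[R[i]]_n) s :
  (forall j, (m1 <= j < m2)%N -> has_deriv (u j) s (d j s)) ->
  has_deriv (fun r => \sum_(m1 <= j < m2) u j r) s (\sum_(m1 <= j < m2) d j s).
Proof.
move=> ud i.
have E (w : nat -> R -> 'cV[R[i]]_n) r : (\sum_(m1 <= j < m2) w j r) i 0 =
    \sum_(m1 <= j < m2 | (m1 <= j < m2)%N && true) w j r i 0.
  by rewrite summxE big_nat_cond.
have -> : (fun r => complex.Re ((\sum_(m1 <= j < m2) u j r) i 0)) = (fun r =>
    complex.Re (\sum_(m1 <= j < m2 | (m1 <= j < m2)%N && true) u j r i 0)).
  by apply/funext => r; rewrite E.
have -> : (fun r => complex.Im ((\sum_(m1 <= j < m2) u j r) i 0)) = (fun r =>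
    complex.Im (\sum_(m1 <= j < m2 | (m1 <= j < m2)%N && true) u j r i 0)).
  by apply/funext => r; rewrite E.
rewrite (E d s); apply: (@cderiv_sum _ _ _ _ (fun j r => u j r i 0) _ (fun j => d j s i 0)) => j.
by rewrite andbT => jm; exact: ud.
Qed.

(** Commutation lets [M] pass through [L]; the zero entry at [p.+1] lets the differentiated tail sum
    be reindexed. *)
Lemma jet_family_step u : jet_family u ->
  jet_family (fun j s => jet_step L (fun m => u m s) j).
Proof.
move=> [du u0]; split=> [j jp s sb|s]; last by rewrite /jet_step big_geq ?mulmx0.
have -> : (fun r => M *m jet_step L (fun m => u m r) j) =
    (fun r => L *m \sum_(j <= m < p.+1) M *m u m r).
  by apply/funext => r; rewrite /jet_step mulmxA ML -mulmxA; congr (_ *m _); rewrite mulmx_sumr.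
rewrite /jet_step; have -> : \sum_(j.+1 <= m < p.+1) u m s =
    \sum_(j <= m < p.+1) u m.+1 s.
  by rewrite [RHS]big_nat_recr //= u0 addr0 big_add1.
apply: has_deriv_mulmx.
apply: (has_deriv_sum (u := fun m r => M *m u m r) (d := fun m r => u m.+1 r)) => m /andP[_ mp].
exact: du.
Qed.

Lemma has_deriv_unique_itv m (f g : R -> 'cV[R[i]]_m) (a b t : R) d e : a < t < b ->
  (forall s, a < s < b -> f s = g s) -> has_deriv f t d -> has_deriv g t e -> d = e.
Proof.
move=> tab fg fd ge; apply/colP => i; apply: (cderiv_unique (f := fun s => g s i 0)) (ge i).
by apply: (cderiv_eq_itv tab _ (fd i)) => s sab; rewrite fg.
Qed.

Lemma jet_solution (u : nat -> R -> 'cV[R[i]]_n) y : jet_family u ->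
  (forall t, 0 < t -> nonmultiple tau t ->
    has_deriv (fun s => M *m y s) t (y t - L *m y (t - tau))) ->
  (forall s, - tau < s < 0 -> y s = u 0%N s) ->
  forall k s, - tau < s < 0 -> y (s + k%:R * tau) = iter k (jet_step L) (fun j => u j s) 0%N.
Proof.
move=> fu dy yu; pose U k j s := iter k (jet_step L) (fun m => u m s) j.
have fU k : jet_family (U k) by elim: k => // k; exact: jet_family_step.
elim=> [|k IH] s sb; first by rewrite mul0r addr0 yu.
(* Only [M *m y] is known to be differentiable, so the identity is proved behind decreasing powers
   of [M]: it is trivial for [M ^+ p.+1 = 0], and differentiating it behind [M ^+ q.+1] gives it
   behind [M ^+ q]. *)
suff H i s' : (i <= p.+1)%N -> - tau < s' < 0 ->
    M ^+ (p.+1 - i) *m y (s' + k.+1%:R * tau) = M ^+ (p.+1 - i) *m U k.+1 0%N s'.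
  by have := H p.+1 s (leqnn _) sb; rewrite subnn !expr0 !mul1mx.
elim: i s' {s sb} => [|i IHi] s ip sb; first by rewrite subn0 Mp !mul0mx.
set q := (p.+1 - i.+1)%N; have qE : (p.+1 - i)%N = q.+1 by rewrite /q; lia.
have [t0 nt] := nonmultiple_interval k sb.
have shiftE : s + k.+1%:R * tau - tau = s + k%:R * tau.
  by rewrite -natr1 mulrDl mul1r addrA addrK.
have d1 : has_deriv (fun r => M ^+ q *m (M *m y (r + k.+1%:R * tau))) s
    (M ^+ q *m (y (s + k.+1%:R * tau) - L *m U k 0%N s)).
  apply: has_deriv_mulmx => j.
  have := cderiv_shift (dy _ t0 nt j); rewrite shiftE.
  by rewrite (IH s sb).
have d2 : has_deriv (fun r => M ^+ q *m (M *m U k.+1 0%N r)) s (M ^+ q *m U k.+1 1%N s).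
  by apply: has_deriv_mulmx; exact: (fU k.+1).1.
have fg r : - tau < r < 0 ->
    M ^+ q *m (M *m y (r + k.+1%:R * tau)) = M ^+ q *m (M *m U k.+1 0%N r).
  move=> rb; have Mq (v : 'cV[R[i]]_n) : M ^+ q *m (M *m v) = M ^+ (p.+1 - i) *m v.
    by rewrite qE exprSr -mulmxE mulmxA.
  by rewrite !Mq; apply: IHi => //; exact: ltnW.
have := has_deriv_unique_itv sb fg d1 d2; rewrite mulmxBr => /(canRL (subrK _)) ->.
rewrite -mulmxDr; congr (_ *m _).
(* Splitting off the term of index 0 shows that the new jet satisfies the equation: entry 0 is [L]
   times the old entry 0 plus the new entry 1. *)
by rewrite /U /= /jet_step [in RHS]big_nat_recl // big_add1 mulmxDr addrC.
Qed.

End Jet.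

(** Multiplying by the inverse of [A] gives the jet equation with [M] nilpotent, and the history
    together with its derivatives up to order [p] supplies the initial jet. *)
Lemma alg_exp_decay p (N A B : 'M[R[i]]_n) : A \in unitmx ->
  N *m A = A *m N -> N *m B = B *m N -> A *m B = B *m A -> N ^+ p.+1 = 0 ->
  (forall l : R[i], 0 <= complex.Re l ->
     \det (l *: N - A - cexp (- (l * (tau%:C)%C)) *: B) != 0) ->
  exists delta gamma : R, [/\ 0 < delta, 0 < gamma &
  forall y ds (x : R), hist_cont tau y ->
  (forall t, 0 < t -> nonmultiple tau t ->
    has_deriv (fun s => N *m y s) t (A *m y t + B *m y (t - tau))) ->
  0 <= x -> (forall s, - tau < s < 0 -> y s = ds 0%N s) ->
  (forall i, (i < p)%N -> forall s, - tau < s < 0 -> has_deriv (ds i) s (ds i.+1 s)) ->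
  (forall i, (i <= p)%N -> forall s, - tau < s < 0 -> forall j, cabs (ds i s j 0) <= x) ->
  forall t, 0 <= t -> forall j, cabs (y t j 0) <= delta * expR (- gamma * t) * x].
Proof.
move=> uA NA NB AB Np det0; pose M := invmx A *m N; pose L := - (invmx A *m B).
have iAN := invmx_comm uA NA; have iAB := invmx_comm uA (esym AB).
have NL : N *m L = L *m N.
  by rewrite /L mulmxN mulNmx mulmxA -iAN -!mulmxA NB.
have ML : M *m L = L *m M.
  rewrite /M -mulmxA NL /L !mulNmx !mulmxN; congr (- _).
  by rewrite [in RHS]mulmxA -[in RHS](mulmxA (invmx A) B) -iAB !mulmxA.
have Mp : M ^+ p.+1 = 0.
  have : GRing.comm (invmx A) N by rewrite /GRing.comm -mulmxE.
  by move=> /(exprMn_comm p.+1); rewrite Np mulr0 -mulmxE.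
have AL : A *m L = - B by rewrite /L mulmxN mulmxA mulmxV // mul1mx.
have LA : L *m A = - B by rewrite /L mulNmx iAB -mulmxA mulVmx // mulmx1.
(* An eigenvalue [a] of [L] with modulus at least 1 equals [cexp (l tau)] for some [l] with
   nonnegative real part. An eigenvector also killed by [N] is then a left null vector of the pencil
   at [l]. *)
have spec a (v : 'rV_n) : v != 0 -> v *m L = a *: v -> cabs a < 1.
  move=> v0 vL; rewrite ltNge; apply/negP => a1.
  have [w [w0 wL wN]] := nilpotent_common_eigenvector (esym NL) Np v0 vL.
  have a0 : a != 0 by rewrite -cabs_gt0 (lt_le_trans ltr01).
  have [b bE] := cexp_surj a0; pose l : R[i] := b / (tau%:C)%C.
  have tC : (tau%:C)%C != 0 :> R[i] by rewrite -cabs_gt0 cabs_real normr_gt0 gt_eqF.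
  have lt : l * (tau%:C)%C = b by rewrite divfK.
  have l0 : 0 <= complex.Re l.
    have : 0 <= complex.Re b by rewrite -ler_expR expR0 -cabs_cexp bE.
    have -> : complex.Re b = complex.Re l * tau.
      by rewrite -lt; case: (l) => ? ? /=; rewrite mulr0 subr0.
    by rewrite pmulr_lge0.
  have := det0 l l0; rewrite lt => /negP; apply; apply/det0P; exists w => //.
  have -> : B = - (L *m A) by rewrite LA opprK.
  rewrite !mulmxBr -!scalemxAr wN scaler0 sub0r mulmxN scalerN opprK mulmxA wL.
  by rewrite -scalemxAl scalerA -bE mulrC cexpK scale1r addNr.
have [C [g [C0 g1 H]]] := jet_step_decay p spec.
have [gam gam0 Hg] := exp_of_geometric tau0 g1.
(* [W] converts bounds on the derivatives [ds i] into bounds on the jet entries [M ^+ i *m ds i]. *)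
pose W := \sum_(i < p.+1) mxsum (M ^+ i).
have W0 : 0 <= W by apply: sumr_ge0 => i _; exact: mxsum_ge0.
exists (C * W + 1), gam; split=> //; first by rewrite ltr_wpDl // mulr_ge0 // ltW.
move=> y ds x cy dy x0 yds dds dsx.
pose u j s := M ^+ j *m ds j s.
have fu : jet_family p M u.
  split=> [j jp s sb|s]; last by rewrite /u Mp mul0mx.
  have [jp'|jp'] := ltnP j p.
    have -> : (fun r => M *m u j r) = fun r => M ^+ j.+1 *m ds j r.
      by apply/funext => r; rewrite /u mulmxA mulmxE -exprS.
    by apply: has_deriv_mulmx; exact: dds.
  (* At the top index the differentiated function carries [M ^+ p.+1 = 0], so derivatives up to
     order [p] suffice. *)
  have -> : j = p by apply/eqP; rewrite eqn_leq jp jp'.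
  have -> : (fun r => M *m u p r) = fun r => M ^+ p.+1 *m (fun=> 0) r.
    by apply/funext => r; rewrite /u mulmxA mulmxE -exprS Mp !mul0mx.
  have -> : u p.+1 s = M ^+ p.+1 *m 0 by rewrite /u Mp !mul0mx.
  by apply: has_deriv_mulmx => i; rewrite mxE; exact: cderiv_cst.
have dM t : 0 < t -> nonmultiple tau t ->
    has_deriv (fun s => M *m y s) t (y t - L *m y (t - tau)).
  move=> t0 nt; have := has_deriv_mulmx (invmx A) (dy t t0 nt).
  rewrite mulmxDr !mulmxA mulVmx // mul1mx /L mulNmx opprK.
  by under eq_fun do rewrite mulmxA.
have yu s : - tau < s < 0 -> y s = u 0%N s by move=> sb; rewrite /u expr0 mul1mx yds.
have sol := jet_solution ML Mp fu dM yu.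
have bnd t : 0 <= t -> nonmultiple tau t -> forall j,
    cabs (y t j 0) <= (C * W + 1) * expR (- gam * t) * x.
  move=> t0 nt j; have [k [s [sb tE tk]]] := nonmultiple_decomposition t0 nt.
  rewrite {1}tE sol //.
  have ux i : (i <= p)%N -> forall j, cabs (u i s j 0) <= W * x.
    move=> ip j'; rewrite (le_trans (mulmx_bound _ (dsx i ip s sb) _)) // ler_wpM2r //.
    rewrite /W (bigD1 (Ordinal (ip : (i < p.+1)%N))) //= lerDl.
    by apply: sumr_ge0 => l _; exact: mxsum_ge0.
  have Wx0 : 0 <= W * x by rewrite mulr_ge0.
  rewrite (le_trans (H _ _ Wx0 ux k 0%N (leq0n _) j)) //.
  have -> : C * g ^- k * (W * x) = C * W * g ^- k * x by ring.
  rewrite ler_wpM2r //; apply: (@le_trans _ _ (C * W * expR (- gam * t))).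
    by rewrite ler_wpM2l ?Hg // mulr_ge0 // ltW.
  by rewrite ler_wpM2r ?expR_ge0 // lerDl.
move=> t t0 j; have [nt|] := pselect (nonmultiple tau t); first exact: bnd.
move=> /existsNP[k /negP/negPn/eqP tE].
have tt : - tau <= t by rewrite (le_trans _ t0) // oppr_le0 ltW.
(* The bound decreases in time, so at points right of [t] it lies below its value at [t]. *)
apply: (cabs_le_right_limit (e := tau) cy tt tau0) => r /andP[r1 r2].
have r0 : 0 <= r by rewrite (le_trans t0) // ltW.
have nr : nonmultiple tau r.
  by apply: (nonmultiple_lt tau0 (k := k)); rewrite -?tE // -natr1 mulrDl mul1r -tE.
rewrite (le_trans (bnd r r0 nr j)) // ler_wpM2r // ler_wpM2l //.
  by rewrite addr_ge0 // mulr_ge0 // ltW.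
by rewrite ler_expR !mulNr lerN2 ler_wpM2l // ltW.
Qed.

End Algebraic.

(** * Diagonal blocks *)

Section Blocks.
Variable R : realType.

(** Linear independence of the rows of [Q]. *)
Definition left_cancel k n (Q : 'M[R[i]]_(k, n)) :=
  forall m (X : 'M[R[i]]_(m, k)), X *m Q = 0 -> X = 0.

Lemma diag4_mul_rows n1 n2 n3 n4 n (M1 : 'M[R[i]]_n1) (M2 : 'M[R[i]]_n2) (M3 : 'M[R[i]]_n3)
  (M4 : 'M[R[i]]_n4) (U1 : 'M[R[i]]_(n1, n)) (U2 : 'M[R[i]]_(n2, n))
  (U3 : 'M[R[i]]_(n3, n)) (U4 : 'M[R[i]]_(n4, n)) :
  diag4 M1 M2 M3 M4 *m col_mx (col_mx U1 U2) (col_mx U3 U4) =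
  col_mx (col_mx (M1 *m U1) (M2 *m U2)) (col_mx (M3 *m U3) (M4 *m U4)).
Proof. by rewrite /diag4 !mul_block_col !mul0mx !addr0 !add0r. Qed.

(** Intertwining by row blocks of [U] lets each block be studied alone, without splitting the
    inverse of [U]. *)
Lemma intertwine_rows n1 n2 n3 n4 (M1 : 'M[R[i]]_n1) (M2 : 'M[R[i]]_n2) (M3 : 'M[R[i]]_n3)
  (M4 : 'M[R[i]]_n4) (M U : 'M[R[i]]_(n1 + n2 + (n3 + n4))) U1 U2 U3 U4 :
  U \in unitmx -> U = col_mx (col_mx U1 U2) (col_mx U3 U4) ->
  U *m M *m invmx U = diag4 M1 M2 M3 M4 ->
  [/\ U1 *m M = M1 *m U1, U2 *m M = M2 *m U2, U3 *m M = M3 *m U3 & U4 *m M = M4 *m U4].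
Proof.
move=> uU UE /(congr1 (mulmx^~ U)); rewrite mulmxKV // [in X in _ = X]UE diag4_mul_rows.
by rewrite UE !mul_col_mx => /eq_col_mx[/eq_col_mx[-> ->] /eq_col_mx[-> ->]].
Qed.

Lemma left_cancel_rows n1 n2 n3 n4 (U : 'M[R[i]]_(n1 + n2 + (n3 + n4))) U1 U2 U3 U4 :
  U \in unitmx -> U = col_mx (col_mx U1 U2) (col_mx U3 U4) ->
  [/\ left_cancel U1, left_cancel U2, left_cancel U3 & left_cancel U4].
Proof.
move=> uU UE.
have inj m (Y : 'M[R[i]]_(m, n1 + n2 + (n3 + n4))) : Y *m U = 0 -> Y = 0.
  by move=> YU; rewrite -[Y](mulmxK uU) YU mul0mx.
have rowE m (X1 : 'M[R[i]]_(m, n1)) (X2 : 'M[R[i]]_(m, n2))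
    (X3 : 'M[R[i]]_(m, n3)) (X4 : 'M[R[i]]_(m, n4)) :
    X1 *m U1 + X2 *m U2 + (X3 *m U3 + X4 *m U4) = 0 ->
    [/\ X1 = 0, X2 = 0, X3 = 0 & X4 = 0].
  rewrite -!mul_row_col -UE => /inj.
  rewrite -[X in _ = X]row_mx0 => /eq_row_mx[].
  by rewrite -!row_mx0 => /eq_row_mx[-> ->] /eq_row_mx[-> ->].
split=> m X XU.
- by have [] := rowE m X 0 0 0; rewrite ?XU ?mul0mx ?addr0.
- by have [] := rowE m 0 X 0 0; rewrite ?XU ?mul0mx ?addr0.
- by have [] := rowE m 0 0 X 0; rewrite ?XU ?mul0mx ?addr0.
- by have [] := rowE m 0 0 0 X; rewrite ?XU ?mul0mx ?addr0.
Qed.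

(** A left null vector [v] of the block pencil lifts to the left null vector [v *m Q] of the whole
    pencil. *)
Lemma block_pencil_det k n (Q : 'M[R[i]]_(k, n)) E A B E1 A1 B1 (l c : R[i]) :
  left_cancel Q -> Q *m E = E1 *m Q -> Q *m A = A1 *m Q -> Q *m B = B1 *m Q ->
  \det (l *: E - A - c *: B) != 0 -> \det (l *: E1 - A1 - c *: B1) != 0.
Proof.
move=> Qf QE QA QB; apply: contra => /det0P[v v0 vP]; apply/det0P.
exists (v *m Q); first by apply: contra v0 => /eqP/Qf ->.
have -> : v *m Q *m (l *: E - A - c *: B) = v *m (l *: E1 - A1 - c *: B1) *m Q.
  rewrite -!mulmxA; congr (_ *m _).
  by rewrite !mulmxBl !mulmxBr -!scalemxAr -!scalemxAl QE QA QB.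
by rewrite vP mul0mx.
Qed.

Lemma block_comm k n (Q : 'M[R[i]]_(k, n)) X Y X1 Y1 : left_cancel Q ->
  Q *m X = X1 *m Q -> Q *m Y = Y1 *m Q -> X *m Y = Y *m X -> X1 *m Y1 = Y1 *m X1.
Proof.
move=> Qf QX QY XY; apply/eqP; rewrite -subr_eq0; apply/eqP; apply: Qf.
by rewrite mulmxBl -!mulmxA -QX -QY !mulmxA -QX -QY -!mulmxA XY subrr.
Qed.

Lemma block_solution k n (tau : R) (Q : 'M[R[i]]_(k, n)) E A B E1 A1 B1 phi x :
  Q *m E = E1 *m Q -> Q *m A = A1 *m Q -> Q *m B = B1 *m Q ->
  is_sol tau E A B (@zerof R n) phi x ->
  hist_cont tau (fun s => Q *m x s) /\
  forall t, 0 < t -> nonmultiple tau t ->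
    has_deriv (fun s => E1 *m (Q *m x s)) t (A1 *m (Q *m x t) + B1 *m (Q *m x (t - tau))).
Proof.
move=> QE QA QB [cx _ _ dx]; split; first exact: (ccont_within_mulmx Q cx).
move=> t t0 nt; have := has_deriv_mulmx Q (dx t (ltW t0) nt).
have -> : (fun s => E1 *m (Q *m x s)) = fun s => Q *m (E *m x s).
  by apply/funext => s; rewrite !mulmxA QE.
by rewrite /zerof addr0 mulmxDr !mulmxA QA QB.
Qed.

Lemma cabs_le_vnorm n (v : 'cV[R[i]]_n) j : cabs (v j 0) <= vnorm v.
Proof. exact: (le_bigmax _ (fun j => cabs (v j 0)) j). Qed.

Lemma vnorm_le n (v : 'cV[R[i]]_n) b : 0 <= b -> (forall j, cabs (v j 0) <= b) -> vnorm v <= b.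
Proof. by move=> b0 vb; apply: bigmax_le => // j _; exact: vb. Qed.

(** [sup] dominates a set only if that set is bounded, which continuity on the compact history
    interval guarantees. *)
Lemma vnorm_le_supn n (tau : R) (g : R -> 'cV[R[i]]_n) s : 0 < tau ->
  ccont_within [set s | - tau <= s <= 0] g -> - tau <= s <= 0 -> vnorm (g s) <= supn tau g.
Proof.
move=> tau0 cg sb; apply: ub_le_sup; last by exists s.
have tn : - tau <= 0 by rewrite oppr_le0 ltW.
have bd (j : 'I_n) : exists c : R, forall r, - tau <= r <= 0 -> cabs (g r j 0) <= c.
  have cj : ccont ((fun s => g s j 0) : subspace [set s | - tau <= s <= 0] -> R[i]) := cg j.
  have := ccont_cabs cj; rewrite -set_itvcc => /(EVT_max tn)[c _ cmax].
  by exists (cabs (g c j 0)) => r rb; apply: cmax; rewrite in_itv.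
have /choice[c cb] := bd.
exists (\sum_j `|c j|) => _ [r rb <-]; apply: vnorm_le; first by apply: sumr_ge0.
move=> j; rewrite (le_trans (cb j r rb)) // (le_trans (ler_norm _)) // (bigD1 j) //=.
by rewrite lerDl sumr_ge0.
Qed.

End Blocks.

(** Common source of both claims: [p] derivatives of the history are enough when the power [p.+1] of
    [NE2] vanishes. *)
Lemma commuting_DDAE_weak_exp_stable (R : realType) (tau : R) (n1 n2 n3 n4 : nat)
  (E A B U : 'M[R[i]]_(n1 + n2 + (n3 + n4)))
  (JE : 'M[R[i]]_n1) (NE2 : 'M[R[i]]_n2) (NE3 : 'M[R[i]]_n3) (NE4 : 'M[R[i]]_n4)
  (A1 : 'M[R[i]]_n1) (JA : 'M[R[i]]_n2) (NA3 : 'M[R[i]]_n3) (NA4 : 'M[R[i]]_n4)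
  (B1 : 'M[R[i]]_n1) (B2 : 'M[R[i]]_n2) (JB : 'M[R[i]]_n3) (NB4 : 'M[R[i]]_n4) (p : nat) :
  0 < tau ->
  E *m A = A *m E -> E *m B = B *m E -> A *m B = B *m A ->
  U \in unitmx ->
  U *m E *m invmx U = diag4 JE NE2 NE3 NE4 ->
  U *m A *m invmx U = diag4 A1 JA NA3 NA4 ->
  U *m B *m invmx U = diag4 B1 B2 JB NB4 ->
  JE \in unitmx -> JA \in unitmx -> JB \in unitmx ->
  NE2 ^+ p.+1 = 0 -> nilpotent NE3 -> nilpotent NA3 -> nilpotent NA4 -> nilpotent NB4 ->
  spectrum tau E A B `<=` [set l | complex.Re l < 0] ->
  weak_exp_stable p tau E A B.
Proof.
move=> tau0 EA EB AB uU dE dA dB uJE uJA uJB Np [k3 Ek3] [l3 Al3] [k4 Ak4] [l4 Bl4] spec.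
pose U1 := usubmx (usubmx U); pose U2 := dsubmx (usubmx U).
pose U3 := usubmx (dsubmx U); pose U4 := dsubmx (dsubmx U).
have UE : U = col_mx (col_mx U1 U2) (col_mx U3 U4) by rewrite !vsubmxK.
have [E1 E2 E3 E4] := intertwine_rows uU UE dE.
have [A1' A2 A3 A4] := intertwine_rows uU UE dA.
have [B1' B2' B3 B4] := intertwine_rows uU UE dB.
have [f1 f2 f3 f4] := left_cancel_rows uU UE.
have det0 l : 0 <= complex.Re l -> \det (l *: E - A - cexp (- (l * (tau%:C)%C)) *: B) != 0.
  move=> l0; apply/eqP => dl; have := spec l dl; rewrite /= ltNge l0; exact: notF.
have n40 : n4 = 0%N.
  apply/eqP; rewrite -leqn0 leqNgt; apply/negP => n4_gt0.
  have := block_pencil_det f4 E4 A4 B4 (det0 0 (lexx _)).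
  rewrite scale0r sub0r (nilpotent_pencil_singular _ n4_gt0 _ Ak4 Bl4) ?eqxx //.
  exact: block_comm f4 A4 B4 AB.
have AB1 := block_comm f1 A1' B1' AB.
have EA1 := block_comm f1 E1 A1' EA.
have EB1 := block_comm f1 E1 B1' EB.
have iA : invmx JE *m A1 = A1 *m invmx JE by apply: invmx_comm.
have iB : invmx JE *m B1 = B1 *m invmx JE by apply: invmx_comm.
have AB1' : invmx JE *m A1 *m (invmx JE *m B1) = invmx JE *m B1 *m (invmx JE *m A1).
  have h X Y : invmx JE *m X = X *m invmx JE ->
      invmx JE *m X *m (invmx JE *m Y) = invmx JE *m (invmx JE *m (X *m Y)).
    move=> iX; rewrite -[LHS]mulmxA; congr (_ *m _).
    by rewrite (mulmxA X) -iX mulmxA.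
  by rewrite (h _ _ B1 iA) (h _ _ A1 iB) AB1.
(* Multiplying by the inverse of [JE] brings the first block to retarded form and changes the
   characteristic determinant by a nonzero factor. *)
have det1 l : 0 <= complex.Re l ->
    \det (l%:M - invmx JE *m A1 - cexp (- (l * (tau%:C)%C)) *: (invmx JE *m B1)) != 0.
  move=> l0; have := block_pencil_det f1 E1 A1' B1' (det0 l l0); apply: contra => /eqP h.
  set c := cexp _ in h *.
  have -> : l *: JE - A1 - c *: B1 =
      JE *m (l%:M - invmx JE *m A1 - c *: (invmx JE *m B1)).
    by rewrite !mulmxBr mul_mx_scalar -scalemxAr !mulmxA mulmxV // !mul1mx.
  by rewrite det_mulmx h mulr0.
have [d1 [g1 [d10 g10 H1]]] := dde_exp_decay tau0 AB1' det1.
have [d2 [g2 [d20 g20 H2]]] := alg_exp_decay tau0 uJA (block_comm f2 E2 A2 EA)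
  (block_comm f2 E2 B2' EB) (block_comm f2 A2 B2' AB) Np
  (fun l l0 => block_pencil_det f2 E2 A2 B2' (det0 l l0)).
(* The slower of the two rates, and one constant dominating both nontrivial blocks. *)
pose gam := Num.min g1 g2; pose W := d1 * mxsum U1 + d2 * mxsum U2.
have W0 : 0 <= W by rewrite addr_ge0 // mulr_ge0 ?mxsum_ge0 // ltW.
exists (mxsum (invmx U) * W + 1), gam; split.
- by rewrite ltr_wpDl // mulr_ge0 // mxsum_ge0.
- by rewrite lt_min g10 g20.
move=> phi x ds [ds0 cds dds] sx t t0.
set X := Cp_norm p tau ds.
have tn : - tau <= (0 : R) <= 0 by rewrite lexx oppr_le0 ltW.
have sup0 i : (i <= p)%N -> 0 <= supn tau (ds i).
  move=> ip; apply: le_trans (vnorm_le_supn tau0 (cds i ip) tn).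
  by rewrite /vnorm; apply: bigmax_ge_id.
have X0 : 0 <= X by apply: sumr_ge0 => i _; apply: sup0; rewrite -ltnS.
have dsX i : (i <= p)%N -> forall s, - tau <= s <= 0 -> forall j, cabs (ds i s j 0) <= X.
  move=> ip s sb j; rewrite (le_trans (cabs_le_vnorm _ j)) //.
  rewrite (le_trans (vnorm_le_supn tau0 (cds i ip) sb)) //.
  rewrite /X /Cp_norm (bigD1 (Ordinal (ip : (i < p.+1)%N))) //= lerDl.
  by apply: sumr_ge0 => l _; apply: sup0; rewrite -ltnS.
have xds s : - tau <= s <= 0 -> x s = ds 0%N s.
  by move=> sb; rewrite ds0 //; case: sx => _ h _ _; exact: h.
have Ege : 0 <= expR (- gam * t) by exact: expR_ge0.
have le1 : expR (- g1 * t) <= expR (- gam * t).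
  by rewrite ler_expR !mulNr lerN2 ler_wpM2r // ge_min lexx.
have le2 : expR (- g2 * t) <= expR (- gam * t).
  by rewrite ler_expR !mulNr lerN2 ler_wpM2r // ge_min lexx orbT.
have y1 j : cabs ((U1 *m x t) j 0) <= W * expR (- gam * t) * X.
  have [cy dy] := block_solution E1 A1' B1' sx.
  have sy : dde_sol tau (invmx JE *m A1) (invmx JE *m B1) (fun s => U1 *m x s).
    split=> // r r0 nr; have := has_deriv_mulmx (invmx JE) (dy r r0 nr).
    rewrite mulmxDr !mulmxA.
    have -> // : (fun s => invmx JE *m (JE *m (U1 *m x s))) = fun s => U1 *m x s.
    by apply/funext => s; rewrite (mulmxA _ JE) mulVmx // mul1mx.
  have hist s : - tau <= s <= 0 -> forall j, cabs ((U1 *m x s) j 0) <= mxsum U1 * X.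
    by move=> sb; apply: mulmx_bound; rewrite xds //; exact: dsX.
  rewrite (le_trans (H1 _ _ sy (mulr_ge0 (mxsum_ge0 _) X0) hist t t0 j)) //.
  rewrite mulrA ler_wpM2r // mulrAC /W mulrDl ler_wpDr //.
    by rewrite !mulr_ge0 ?mxsum_ge0 // ltW.
  by rewrite ler_wpM2l // mulr_ge0 ?mxsum_ge0 // ltW.
have y2 j : cabs ((U2 *m x t) j 0) <= W * expR (- gam * t) * X.
  have [cy dy] := block_solution E2 A2 B2' sx.
  have yds s : - tau < s < 0 -> U2 *m x s = U2 *m ds 0%N s.
    by move=> /andP[s1 s2]; rewrite xds // !ltW.
  have dd i : (i < p)%N -> forall s, - tau < s < 0 ->
      has_deriv (fun s => U2 *m ds i s) s (U2 *m ds i.+1 s).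
    by move=> ip s sb; apply: has_deriv_mulmx; exact: dds.
  have hist i : (i <= p)%N -> forall s, - tau < s < 0 -> forall j,
      cabs ((U2 *m ds i s) j 0) <= mxsum U2 * X.
    by move=> ip s /andP[s1 s2]; apply: mulmx_bound; apply: dsX; rewrite ?(ltW s1) ?(ltW s2).
  rewrite (le_trans (H2 _ _ _ cy dy (mulr_ge0 (mxsum_ge0 _) X0) yds dd hist t t0 j)) //.
  rewrite mulrA ler_wpM2r // mulrAC /W mulrDl ler_wpDl //.
    by rewrite !mulr_ge0 ?mxsum_ge0 // ltW.
  by rewrite ler_wpM2l // mulr_ge0 ?mxsum_ge0 // ltW.
have rhs0 : 0 <= W * expR (- gam * t) * X by rewrite !mulr_ge0.
have y3 j : cabs ((U3 *m x t) j 0) <= W * expR (- gam * t) * X.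
  have [cy dy] := block_solution E3 A3 B3 sx.
  rewrite (advanced_solution_eq0 tau0 (block_comm f3 E3 A3 EA) (block_comm f3 E3 B3 EB)
    (block_comm f3 A3 B3 AB) uJB Ek3 Al3 cy dy) ?mxE ?cabs0 //.
  by rewrite (le_trans _ t0) // oppr_le0 ltW.
have yU j : cabs ((U *m x t) j 0) <= W * expR (- gam * t) * X.
  rewrite [in X in cabs X]UE !mul_col_mx.
  case: (split_ordP j) => j' ->; case: (split_ordP j') => j'' ->.
  - by rewrite !col_mxEu.
  - by rewrite col_mxEu col_mxEd.
  - by rewrite col_mxEd col_mxEu.
  - by exfalso; move: j'' => [m]; rewrite n40.
have c0 : 0 <= mxsum (invmx U) by exact: mxsum_ge0.
apply: vnorm_le => [|j]; first by rewrite !mulr_ge0 // addr_ge0 // mulr_ge0.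
have -> : x t = invmx U *m (U *m x t) by rewrite mulmxA mulVmx // mul1mx.
rewrite (le_trans (mulmx_bound (invmx U) yU j)) // !mulrA ler_wpM2r // ler_wpM2r //.
by rewrite lerDl.
Qed.

(** * The two stability statements *)

Unset Implicit Arguments.

Theorem theorem7 (R : realType) (tau : R) (n1 n2 n3 n4 : nat)
  (E A B U : 'M[R[i]]_(n1 + n2 + (n3 + n4)))
  (JE : 'M[R[i]]_n1) (NE2 : 'M[R[i]]_n2) (NE3 : 'M[R[i]]_n3) (NE4 : 'M[R[i]]_n4)
  (A1 : 'M[R[i]]_n1) (JA : 'M[R[i]]_n2) (NA3 : 'M[R[i]]_n3) (NA4 : 'M[R[i]]_n4)
  (B1 : 'M[R[i]]_n1) (B2 : 'M[R[i]]_n2) (JB : 'M[R[i]]_n3) (NB4 : 'M[R[i]]_n4) :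
  0 < tau ->
  E *m A = A *m E -> E *m B = B *m E -> A *m B = B *m A ->
  uniquely_solvable tau E A B ->
  U \in unitmx ->
  U *m E *m invmx U = diag4 JE NE2 NE3 NE4 ->
  U *m A *m invmx U = diag4 A1 JA NA3 NA4 ->
  U *m B *m invmx U = diag4 B1 B2 JB NB4 ->
  JE \in unitmx -> JA \in unitmx -> JB \in unitmx ->
  nilpotent NE2 -> nilpotent NE3 -> nilpotent NE4 ->
  nilpotent NA3 -> nilpotent NA4 -> nilpotent NB4 ->
  (* (i) *)
  (spectrum tau E A B `<=` [set l | complex.Re l < 0] -> NE2 = 0 ->
     exp_stable tau E A B) /\
  (* (ii) zeta = nilpotency index of NE2 *)
  (spectrum tau E A B `<=` [set l | complex.Re l < 0] ->
     forall zeta : nat, NE2 ^+ zeta = 0 -> (forall k, (k < zeta)%N -> NE2 ^+ k != 0) ->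
     weak_exp_stable zeta tau E A B).
Proof.
move=> tau0 EA EB AB _ uU dE dA dB uJE uJA uJB _ NE3n _ NA3n NA4n NB4n.
have stab p : NE2 ^+ p.+1 = 0 ->
    spectrum tau E A B `<=` [set l | complex.Re l < 0] -> weak_exp_stable p tau E A B.
  by move=> Np; apply: (commuting_DDAE_weak_exp_stable tau0 EA EB AB uU dE dA dB).
split=> [spec NE0|spec zeta Nz _].
  (* For [NE2 = 0] the order [p = 0] is allowed, and the norm of order 0 is the supremum norm. *)
  have [delta [gamma [d0 g0 H]]] : weak_exp_stable 0 tau E A B.
    by apply: stab spec; rewrite NE0 expr1.
  exists delta, gamma; split=> // phi x cphi sx t t0.
  have := H phi x (fun=> phi) _ sx t t0; rewrite /Cp_norm big_ord_recl big_ord0 addr0.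
  by apply; split.
(* If the power [zeta] of [NE2] vanishes, so does the power [zeta.+1], which allows [p = zeta]. *)
by apply: stab spec; rewrite exprS Nz mulr0.
Qed.
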